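(* Let $n\in\mathbb{N}$ be fixed, let $\pmb{\alpha}^*=(\alpha_1^*,\dots,\alpha_n^* )'\in\mathbb{R}^n$, and let $\phi,\phi_\varepsilon\in\mathbb{R}$ with $|\phi|<1$, $|\phi_\varepsilon|<1$. Let the data be generated by $$y_t=\sum_{i=1}^n\alpha_i^*x_{i,t-1}+\varepsilon_t,\qquad x_{it}=\phi\, x_{i,t-1}+u_{it}\quad(i=1,\dots,n),\qquad \varepsilon_t=\phi_\varepsilon\varepsilon_{t-1}+\omega_t ,$$ where, for each $i$, $(u_{it})_t$ is i.i.d. and $(\omega_t)_t$ is i.i.d. Assume: (1) $u_{it}\perp u_{j,t-l}$ for all $i,j,t$ and all $l\neq 0$; (2) $u_{i,t-l}\perp\omega_t$ for all $i,t,l$. Let $\sigma_y^2$ be the variance of $y_t$, let $\mathbf{C}_x$ be the $n\times n$ matrix with $\mathbf{X}\mathbf{X}'/T\overset{p}{\to}\mathbf{C}_x$ as $T\to\infty$ (where $\mathbf{X}$ is the $n\times T$ matrix with entries $x_{it}$), and let $R^2={\pmb{\alpha}^*}'\mathbf{C}_x\pmb{\alpha}^*/\sigma_y^2$. Then, as $T\to\infty$: (a) the ordinary least squares estimates $(\widehat{\phi}_y,\widehat{\pmb{\alpha}})$ of the coefficients in the regression of $y_t$ on $(y_{t-1},x_{1,t-1},\dots,x_{n,t-1})$, that is, for the model $y_t=\sum_{i=1}^n\alpha_i x_{i,t-1}+\phi_y y_{t-1}+\text{error}$, satisfy $$\widehat{\phi}_y\ \overset{p}{\to}\ \frac{\phi_\varepsilon(1-R^2)}{1-\phi^2R^2},\qquad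 \widehat{\pmb{\alpha}}\ \overset{p}{\to}\ \pmb{\alpha}^*\left(1-\frac{\phi\,\phi_\varepsilon(1-R^2)}{1-\phi^2R^2}\right);$$ (b) the ordinary least squares estimates $(\widehat{\phi}_y,\widehat{\pmb{\alpha}})$ of the coefficients in the regression of $y_t$ on $(y_{t-1},u_{1,t-1},\dots,u_{n,t-1})$, that is, for the model $y_t=\sum_{i=1}^n\alpha_i u_{i,t-1}+\phi_y y_{t-1}+\text{error}$, where the $u_{i,t-1}$ are treated as observed, satisfy $$\widehat{\phi}_y\ \overset{p}{\to}\ \phi R^2+\phi_\varepsilon(1-R^2),\qquad \widehat{\pmb{\alpha}}\ \overset{p}{\to}\ \pmb{\alpha}^* .$$
   Context: The processes are indexed by $t\in\mathbb{Z}$. Standing assumptions: the joint process $\{(y_t,x_{1t},\dots,x_{nt})\}_{t\in\mathbb{Z}}$ is Gaussian, strictly stationary and absolutely regular ($\beta$-mixing); the random errors $u_{it}$ and $\omega_t$ have zero mean; the covariance matrix $\mathbf{C}_x=E[\mathbf{x}_t\mathbf{x}_t']$, $\mathbf{x}_t=(x_{1t},\dots,x_{nt})'$, is positive definite (and $\sigma_y^2>0$). The symbol $\perp$ denotes independence. Contemporaneous dependence between $u_{it}$ and $u_{jt}$, $i\ne j$, is allowed. The least squares regressions contain no intercept, and are computed from the observations $t=1,\dots,T$ (with the necessary lagged values available). $\overset{p}{\to}$ denotes convergence in probability. *)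

(* Defs.v *)
From HB Require Import structures.
From mathcomp Require Import all_boot all_order all_algebra.
From mathcomp Require Import all_classical all_reals all_analysis.

Set Implicit Arguments.
Unset Strict Implicit.
Unset Printing Implicit Defensive.

Import Order.TTheory GRing.Theory Num.Theory.
Import numFieldNormedType.Exports.

Local Open Scope classical_set_scope.
Local Open Scope ring_scope.

Section RandomVariables.
Context {d : measure_display} {T : measurableType d} {R : realType}.
Variable P : probability T R.

Definition indep (X Y : T -> R) : Prop :=
  forall A B : set R, measurable A -> measurable B ->
  P (X @^-1` A `&` Y @^-1` B) = (P (X @^-1` A) * P (Y @^-1` B))%E.

(* Mutual (not merely pairwise) independence, plus equality of the laws. *)
Definition iid (X : int -> T -> R) : Prop :=
  (forall (s : seq int) (A : int -> set R), uniq s ->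
     (forall t, measurable (A t)) ->
     P (\bigcap_(t in [set` s]) (X t @^-1` A t)) =
       (\prod_(t <- s) P (X t @^-1` A t))%E) /\
  (forall (s t : int) (A : set R), measurable A ->
     P (X s @^-1` A) = P (X t @^-1` A)).

(* [normal_prob m 0] is not a point mass, hence the separate degenerate case. *)
Definition gaussian (X : T -> R) : Prop :=
  exists m s : R, 0 <= s /\
    forall A : set R, measurable A ->
      P (X @^-1` A) = if s == 0 then \d_m A else normal_prob m s A.

Definition cvg_in_prob (X : nat -> T -> R) (l : R) : Prop :=
  forall e : R, 0 < e ->
    P [set w | e < `|X N w - l|] @[N --> \oo] --> 0%E.

End RandomVariables.

Section Processes.
Context {d : measure_display} {T : measurableType d} {R : realType}.
Variable P : probability T R.
(* A vector process: [Z t j] is the component [j] at time [t]. *)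
Context {J : Type}.
Variable Z : int -> J -> T -> R.

Definition gaussian_process : Prop :=
  forall (k : nat) (t : 'I_k -> int) (j : 'I_k -> J) (c : 'I_k -> R),
    gaussian P (fun w => \sum_(i < k) c i * Z (t i) (j i) w).

(* The events [A] range over the product sigma-algebra of k.-tuple R. *)
Definition strictly_stationary : Prop :=
  forall (k : nat) (t : 'I_k -> int) (j : 'I_k -> J) (h : int)
         (A : set (k.-tuple R)), measurable A ->
    P [set w | A [tuple Z (t i + h) (j i) w | i < k]] =
    P [set w | A [tuple Z (t i) (j i) w | i < k]].

Definition sigma_over (I : set int) : set (set T) :=
  <<s [set E | exists t j (B : set R),
         [/\ I t, measurable B & E = Z t j @^-1` B]] >>.

Definition finite_partition (F : set (set T)) (k : nat)
    (A : 'I_k -> set T) : Prop :=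
  [/\ forall i, F (A i), trivIset setT A & \bigcup_i A i = setT].

(* The beta (absolute regularity) dependence coefficient of two sigma-algebras:
   sup of (1/2) sum_i sum_j |P(A_i /\ B_j) - P(A_i) P(B_j)| over all pairs of
   finite partitions of the sample space, (A_i) in F and (B_j) in G. *)
Definition beta_coef (F G : set (set T)) : \bar R :=
  ereal_sup [set b | exists k l (A : 'I_k -> set T) (B : 'I_l -> set T),
    [/\ finite_partition F A, finite_partition G B &
        b = (2^-1 * \sum_(i < k) \sum_(j < l)
              `|fine (P (A i `&` B j)) - fine (P (A i)) * fine (P (B j))|)%:E]].

Definition absolutely_regular : Prop :=
  (fun k : nat => ereal_sup (range (fun t : int =>
     beta_coef (sigma_over [set s | s <= t])
               (sigma_over [set s | t + k%:Z <= s])))) @ \oo --> 0%E.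

End Processes.

Section LeastSquares.
Context {R : realType} {n : nat}.
(* Regression without intercept of y_t on (y_{t-1}, z_{1,t-1}, ..., z_{n,t-1})
   for t = 1, ..., N. *)
Variables (y : int -> R) (z : 'I_n -> int -> R) (N : nat).

Definition rss (phiy : R) (alpha : 'cV[R]_n) : R :=
  \sum_(1 <= t < N.+1)
    (y t%:Z - \sum_(i < n) alpha i 0 * z i (t%:Z - 1)
       - phiy * y (t%:Z - 1)) ^+ 2.

Definition rss_minimizer (phiy : R) (alpha : 'cV[R]_n) : Prop :=
  forall phiy' alpha', rss phiy alpha <= rss phiy' alpha'.

(* The least squares estimate is the minimizer of the residual sum of squares;
   its value is left unspecified on the samples for which the minimizer is not
   unique (singular design, e.g. N <= n). *)
Definition ols_estimate (phiy : R) (alpha : 'cV[R]_n) : Prop :=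
  forall p a, rss_minimizer p a ->
    (forall p' a', rss_minimizer p' a' -> p' = p /\ a' = a) ->
    phiy = p /\ alpha = a.

End LeastSquares.

Definition positive_definite {R : realType} {n : nat} (C : 'M[R]_n) : Prop :=
  C^T = C /\ forall v : 'cV[R]_n, v != 0 -> 0 < (v^T *m C *m v) 0 0.

(* The joint process (y_t, x_1t, ..., x_nt): None indexes y, Some i indexes x_i. *)
Definition joint_process {T : Type} {R : realType} {n : nat}
    (y : int -> T -> R) (x : 'I_n -> int -> T -> R)
    (t : int) (j : option 'I_n) : T -> R :=
  if j is Some i then x i t else y t.

(* Main.v *)
Require Import Defs.
From HB Require Import structures.
From mathcomp Require Import all_boot all_order all_algebra.
From mathcomp Require Import all_classical all_reals all_analysis.
From mathcomp Require Import measurable_realfun.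
From mathcomp Require Import ring lra zify.

Set Implicit Arguments.
Unset Strict Implicit.
Unset Printing Implicit Defensive.

Import Order.TTheory GRing.Theory Num.Theory.
Import numFieldNormedType.Exports.

Local Open Scope classical_set_scope.
Local Open Scope ring_scope.

(** A least squares estimate solves normal equations whose coefficients are
    sample second moments of the response and of the regressors.  So it suffices
    to know that these sample moments converge in probability, that the limit of
    the design moments is an invertible matrix, and what the solution of the
    limiting system is.

    Convergence of the sample moments (cvg_in_prob_filtered).  For centred jointly
    Gaussian variables, Isserlis' theorem gives
    Cov (A ^ 2, B ^ 2) = 2 E[A B] ^ 2.  Hence the variance of the time average of
    Z_t ^ 2 over N dates is at most a constant times the Cesaro mean of the squared
    autocovariances of Z, and it tends to 0 as soon as the autocovariances do
    (cvg_in_prob_sqr); products A_t B_t follow by polarisation.  Isserlis' theorem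
    for squares in turn only needs E[X ^ 4] = 3 E[X ^ 2] ^ 2 for a centred Gaussian
    variable, which is read off from Stein's identity (normal_moment_rec), because
    the linear span of a Gaussian process consists of Gaussian variables.

    Population moments.  Iterating x_t = phi x_{t-1} + u_t backwards shows that x_t is
    orthogonal in L^2 to every variable to which its present and past innovations
    are orthogonal (ar_orthogonal).  This yields E[x_s u_t] = 0 for s < t,
    E[x_s eps_t] = 0 for all s and t, and geometrically decaying autocovariances.
    Write C for the covariance matrix of x_t, c = C alpha, q = alpha' C alpha and
    s = sigma_y ^ 2, so that E[eps_t ^ 2] = s - q.  The limiting systems for the
    coefficients (p, a) of (y_{t-1}, x_{t-1}) and of (y_{t-1}, u_{t-1}) are

      s p + phi c' a = phi q + phi_eps (s - q)      phi c p + C a = c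

      s p = phi q + phi_eps (s - q)      (1 - phi ^ 2) C a = (1 - phi ^ 2) c

    In the first one, elimination of a = (1 - phi p) alpha leaves
    (s - phi ^ 2 q) p = phi_eps (s - q), with a positive pivot because q <= s; so
    both systems are invertible, and with R ^ 2 = q / s their solutions are the
    stated limits.

    Passage to the limit (ols_consistent).  A linear system whose coefficients are
    close to those of an invertible one is itself invertible and has a nearby
    solution (linear_system_continuous), so that on an event of probability tending
    to 1 the least squares problem has a unique minimizer, close to the limit. *)

(** * Moments of the normal distribution *)

Section NormalMoments.
Context {R : realType}.
Variables (m s : R).
Hypothesis s0 : s != 0.
Notation mu := (@lebesgue_measure R).
Notation pdf := (normal_pdf m s).

Lemma normal_pdf_expR x :
  pdf x = normal_peak s * expR (- ((x - m) ^+ 2 / (s ^+ 2 *+ 2))).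
Proof. by rewrite normal_pdfE// /normal_fun mulNr. Qed.

(** Integration against the normal law is integration against its density: the
    Radon-Nikodym derivative agrees almost everywhere with normal_pdf. *)
Lemma ge0_integral_normal_prob (f : R -> \bar R) :
  (forall x, 0 <= f x)%E -> measurable_fun [set: R] f ->
  (\int[normal_prob m s]_x f x = \int[mu]_x (f x * (pdf x)%:E))%E.
Proof.
move=> f0 mf.
have dom := normal_prob_dominates m s.
rewrite -(Radon_Nikodym_SigmaFinite.change_of_variables dom)//.
have intf := Radon_Nikodym_SigmaFinite.f_integrable dom.
apply: ae_eq_integral => //.
- by apply: emeasurable_funM => //; exact: (measurable_int _ intf).
- apply: emeasurable_funM => //; apply/measurable_EFinP.
  exact: measurable_normal_pdf.
- apply: ae_eqe_mul2l.
  apply: integral_ae_eq => //.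
    by apply/measurable_EFinP; exact: measurable_normal_pdf.
  by move=> E _ mE; rewrite -Radon_Nikodym_SigmaFinite.f_integral.
Qed.

Lemma integral_normal_prob (f : R -> \bar R) :
  (normal_prob m s).-integrable setT f ->
  (\int[normal_prob m s]_x f x = \int[mu]_x (f x * (pdf x)%:E))%E.
Proof.
move=> intf.
have dom := normal_prob_dominates m s.
rewrite -(Radon_Nikodym_change_of_variables dom)//.
have mf := measurable_int _ intf.
apply: ae_eq_integral => //.
- by apply: emeasurable_funM => //; apply: (measurable_int mu).
- apply: emeasurable_funM => //; apply/measurable_EFinP.
  exact: measurable_normal_pdf.
- apply: ae_eqe_mul2l.
  apply: integral_ae_eq => //.
  + by apply: Radon_Nikodym_integrable; exact: dom.
  + by apply/measurable_EFinP; exact: measurable_normal_pdf.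
  + by move=> E _ mE; rewrite -Radon_Nikodym_integral.
Qed.

(** From z ^ 2 / 2 <= exp z, the only growth property of exp from which the
    finiteness of the moments and the vanishing boundary terms are derived. *)
Lemma sqr_expRN_le (z : R) : 0 <= z -> z ^+ 2 * expR (- z) <= 2.
Proof.
move=> z0; have := expR_ge1Dxn 1 z0.
rewrite expRN ler_pdivrMr ?expR_gt0// => h.
have -> : 2%:R = (2`!)%:R :> R by [].
rewrite mulrC -ler_pdivrMr ?ltr0n//.
by apply: le_trans h; rewrite lerDr ler01.
Qed.

Lemma measurable_subXn_pdf k :
  measurable_fun [set: R] (fun x : R => (x - m) ^+ k * pdf x : R).
Proof.
apply: measurable_funM; last exact: measurable_normal_pdf.
by apply: measurable_funX; exact: measurable_funB.
Qed.

(** Half of the exponent absorbs the polynomial; what remains is a multiple of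
    the normal density with variance 2 s ^ 2. *)
Lemma integrable_subX4_pdf :
  mu.-integrable [set: R] (fun x : R => ((x - m) ^+ 4 * pdf x)%:E).
Proof.
pose s' := Num.sqrt 2 * s.
have s'0 : s' != 0 by rewrite mulf_neq0// sqrtr_eq0 -ltNge.
have s'2 : s' ^+ 2 = 2 * s ^+ 2 by rewrite exprMn sqr_sqrtr.
pose C := normal_peak s * 32 * s ^+ 4 / normal_peak s'.
have : mu.-integrable [set: R] (fun x : R => (C * normal_pdf m s' x)%:E).
  exact: (integrableZl measurableT C (integrable_normal_pdf m s')).
apply: le_integrable => //.
  by apply/measurable_EFinP; exact: measurable_subXn_pdf.
move=> x _; rewrite /= lee_fin.
have C0 : 0 <= C.
  rewrite divr_ge0 ?normal_peak_ge0// mulr_ge0 ?exprn_even_ge0//.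
  by rewrite mulr_ge0 ?normal_peak_ge0.
rewrite [leLHS]ger0_norm; last by apply: mulr_ge0; rewrite ?normal_pdf_ge0// exprn_even_ge0.
rewrite ger0_norm; last by apply: mulr_ge0; rewrite ?normal_pdf_ge0.
rewrite normal_pdf_expR (normal_pdfE m s'0) /normal_fun s'2.
set z := (x - m) ^+ 2 / (2 * s ^+ 2 *+ 2).
have z0 : 0 <= z by rewrite divr_ge0 ?sqr_ge0// mulrn_wge0// mulr_ge0// sqr_ge0.
have -> : - ((x - m) ^+ 2 / (s ^+ 2 *+ 2)) = - z + - z.
  by rewrite /z; field.
have -> : - (x - m) ^+ 2 / (2 * s ^+ 2 *+ 2) = - z by rewrite mulNr.
have -> : (x - m) ^+ 4 = z ^+ 2 * (16 * s ^+ 4) by rewrite /z; field.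
rewrite expRD.
have -> : C * (normal_peak s' * expR (- z)) = normal_peak s * 32 * s ^+ 4 * expR (- z).
  by rewrite /C; field; rewrite gt_eqF// normal_peak_gt0.
have -> : z ^+ 2 * (16 * s ^+ 4) * (normal_peak s * (expR (- z) * expR (- z))) =
  (normal_peak s * s ^+ 4 * expR (- z) * 16) * (z ^+ 2 * expR (- z)) by ring.
have -> : normal_peak s * 32 * s ^+ 4 * expR (- z) =
  (normal_peak s * s ^+ 4 * expR (- z) * 16) * 2 by ring.
apply: ler_wpM2l; last exact: sqr_expRN_le.
have p1 := normal_peak_ge0 s; have p2 := expR_ge0 (- z).
have p3 : 0 <= s ^+ 4 by rewrite exprn_even_ge0.
by do 3 (apply: mulr_ge0; last by []).
Qed.

Lemma normX_le_X4 (t : R) k : (k <= 4)%N -> `|t| ^+ k <= 1 + t ^+ 4.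
Proof.
move=> k4; have [t1|t1] := leP `|t| 1.
  by apply: (@le_trans _ _ 1); rewrite ?exprn_ile1// lerDl exprn_even_ge0.
apply: (@le_trans _ _ (`|t| ^+ 4)).
  by rewrite ler_eXn2l.
by rewrite -normrX ger0_norm ?exprn_even_ge0// lerDr.
Qed.

Lemma integrable_subXn_pdf k : (k <= 4)%N ->
  mu.-integrable [set: R] (fun x : R => ((x - m) ^+ k * pdf x)%:E).
Proof.
move=> k4.
have : mu.-integrable [set: R]
    (fun x : R => (pdf x)%:E + ((x - m) ^+ 4 * pdf x)%:E)%E.
  apply: integrableD => //; first exact: integrable_normal_pdf.
  exact: integrable_subX4_pdf.
apply: le_integrable => //.
  by apply/measurable_EFinP; exact: measurable_subXn_pdf.
move=> x _; rewrite /= lee_fin.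
rewrite [leRHS]ger0_norm; last first.
  rewrite addr_ge0 ?normal_pdf_ge0//; apply: mulr_ge0; last exact: normal_pdf_ge0.
  by rewrite exprn_even_ge0.
rewrite normrM (ger0_norm (normal_pdf_ge0 _ _ _)) normrX.
have -> : pdf x + (x - m) ^+ 4 * pdf x = (1 + (x - m) ^+ 4) * pdf x by ring.
by apply: ler_wpM2r; rewrite ?normal_pdf_ge0// normX_le_X4.
Qed.

Lemma is_derive_subXn_pdf k (x : R) :
  is_derive x 1 (fun x : R => (x - m) ^+ k * pdf x)
    (k%:R * ((x - m) ^+ k.-1 * pdf x) - s ^- 2 * ((x - m) ^+ k.+1 * pdf x)).
Proof.
have -> : (fun x : R => (x - m) ^+ k * pdf x) =
   ((fun x : R => x - m) ^+ k *
    (fun x : R => normal_peak s * expR (- ((x - m) ^+ 2 / (s ^+ 2 *+ 2))))).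
  by apply/funext => y; rewrite normal_pdf_expR /= /GRing.mul/= exprfctE.
have d1 : is_derive x 1 (fun x : R => x - m) 1.
  have -> : (fun x : R => x - m) = id - cst m by [].
  by apply: is_derive_eq; rewrite subr0.
have d2 : is_derive x 1 (fun x : R => - ((x - m) ^+ 2 / (s ^+ 2 *+ 2)))
    (- ((x - m) / s ^+ 2)).
  have -> : (fun x : R => - ((x - m) ^+ 2 / (s ^+ 2 *+ 2))) =
    (- (s ^+ 2 *+ 2)^-1) *: (fun x : R => x - m) ^+ 2.
    by apply/funext => y; rewrite scalrfctE exprfctE /GRing.scale/= mulNr mulrC.
  by apply: is_derive_eq; rewrite /GRing.scale/= expr1; field.
have d3 : is_derive x 1
    (fun x : R => normal_peak s * expR (- ((x - m) ^+ 2 / (s ^+ 2 *+ 2))))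
    (- s ^- 2 * ((x - m) * pdf x)).
  rewrite normal_pdf_expR.
  have -> : (fun x : R => normal_peak s * expR (- ((x - m) ^+ 2 / (s ^+ 2 *+ 2)))) =
     normal_peak s *: (expR \o (fun x : R => - ((x - m) ^+ 2 / (s ^+ 2 *+ 2)))) by [].
  have dc := is_derive1_comp (is_derive_expR _) d2.
  have := is_deriveZ (normal_peak s) dc => /is_derive_eq; apply.
  by rewrite /GRing.scale/=; field.
apply: is_derive_eq; rewrite /GRing.scale/= -normal_pdf_expR.
by rewrite exprfctE /= [_ ^+ k.+1]exprS; set q := _ ^+ k.-1; set r := _ ^+ k; field.
Qed.

(** A uniform bound on the fourth power makes the boundary terms of the
    integration by parts, which involve at most third powers, O(1 / N). *)
Lemma subX4_pdf_le x : (x - m) ^+ 4 * pdf x <= 8 * s ^+ 4 * normal_peak s.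
Proof.
rewrite normal_pdf_expR; set z := (x - m) ^+ 2 / (s ^+ 2 *+ 2).
have z0 : 0 <= z by rewrite divr_ge0 ?sqr_ge0// mulrn_wge0// sqr_ge0.
have -> : (x - m) ^+ 4 = z ^+ 2 * (4 * s ^+ 4) by rewrite /z; field.
have -> : z ^+ 2 * (4 * s ^+ 4) * (normal_peak s * expR (- z)) =
  (4 * s ^+ 4 * normal_peak s) * (z ^+ 2 * expR (- z)) by ring.
have -> : 8 * s ^+ 4 * normal_peak s = 4 * s ^+ 4 * normal_peak s * 2 by ring.
apply: ler_wpM2l; last exact: sqr_expRN_le.
by apply: mulr_ge0; [apply: mulr_ge0 => //; rewrite exprn_even_ge0|exact: normal_peak_ge0].
Qed.

Lemma subXn_pdf_le (N : nat) k x : (k <= 3)%N -> `|x - m| = N.+1%:R ->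
  `|(x - m) ^+ k * pdf x| <= 8 * s ^+ 4 * normal_peak s / N.+1%:R.
Proof.
move=> k3 xN; have N0 : 0 < N.+1%:R :> R by rewrite ltr0n.
rewrite ler_pdivlMr//.
apply: le_trans (subX4_pdf_le x).
rewrite normrM (ger0_norm (normal_pdf_ge0 _ _ _)) mulrAC.
apply: ler_wpM2r; first exact: normal_pdf_ge0.
rewrite -[leRHS]ger0_norm ?exprn_even_ge0// !normrX xN -exprSr.
by rewrite ler_weXn2l// ler1n.
Qed.

Let h k (x : R) : R :=
  k%:R * ((x - m) ^+ k.-1 * pdf x) - s ^- 2 * ((x - m) ^+ k.+1 * pdf x).

Let integrable_h k : (k <= 3)%N -> mu.-integrable [set: R] (EFin \o h k).
Proof.
move=> k3.
have k1 : (k.-1 <= 4)%N by case: k k3 => // k; lia.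
have i1 := integrableZl measurableT k%:R (integrable_subXn_pdf k1).
have i2 := integrableZl measurableT (s ^- 2) (@integrable_subXn_pdf k.+1 k3).
exact: (integrableB measurableT i1 i2).
Qed.

Let continuous_subXn_pdf k : continuous (fun x : R => (x - m) ^+ k * pdf x).
Proof.
move=> x; apply: differentiable_continuous.
by apply/derivable1_diffP; case: (is_derive_subXn_pdf k x).
Qed.

Let continuous_h k : continuous (h k).
Proof.
move=> x; apply: cvgB.
  by apply: cvgMr; exact: continuous_subXn_pdf.
by apply: cvgMr; exact: continuous_subXn_pdf.
Qed.

Let integral_h k (a b : R) : a < b ->
  (\int[mu]_(x in `[a, b]) (h k x)%:E =
    ((b - m) ^+ k * pdf b)%:E - ((a - m) ^+ k * pdf a)%:E)%E.
Proof.
move=> ab; rewrite (@continuous_FTC2 _ _ (fun x : R => (x - m) ^+ k * pdf x))//.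
- by apply: continuous_subspaceT; exact: continuous_h.
- split.
  + by move=> x _; case: (is_derive_subXn_pdf k x).
  + exact/cvg_at_right_filter/continuous_subXn_pdf.
  + exact/cvg_at_left_filter/continuous_subXn_pdf.
- move=> x _; rewrite derive1E.
  by have H := is_derive_subXn_pdf k x; rewrite derive_val.
Qed.

Let integral_h0 k : (k <= 3)%N -> (\int[mu]_x (h k x)%:E = 0)%E.
Proof.
move=> k3; have ih := integrable_h k3.
pose D (n : nat) : set R := `[m - n.+1%:R, m + n.+1%:R]%classic.
pose f_ (n : nat) := (EFin \o h k) \_ (D n).
have [] := @dominated_convergence _ _ _ mu [set: R] measurableT f_ (EFin \o h k)
  (abse \o (EFin \o h k)).
- move=> n; apply/(measurable_restrictT _ _).1; first exact: measurable_itv.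
  by apply: measurable_funTS; exact: measurable_int ih.
- exact: measurable_int ih.
- apply: aeW => x _; apply: cvg_near_cst.
  exists (Num.truncn `|x - m|) => // n /= nx; rewrite /f_ patchE mem_set//.
  rewrite /D/= in_itv/=.
  have : `|x - m| <= n.+1%:R.
    by apply: ltW; apply: lt_le_trans (truncnS_gt _) _; rewrite ler_nat.
  by rewrite ler_norml; lra.
- exact: integrable_abse.
- apply: aeW => x n _; rewrite /f_ patchE; case: ifPn => //= _.
  by rewrite normr0 lee_fin.
move=> _ _.
rewrite (_ : [sequence _]_n = EFin \o (fun n : nat =>
   ((m + n.+1%:R - m) ^+ k * pdf (m + n.+1%:R)) -
   ((m - n.+1%:R - m) ^+ k * pdf (m - n.+1%:R)))); last first.
  apply/funext => n /=; rewrite /f_ -integral_mkcond integral_h ?EFinB//.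
  by rewrite ltrD2l; apply: (@lt_trans _ _ 0); rewrite ?oppr_lt0 ltr0n.
rewrite -[X in _ --> X](fineK (integrable_fin_num measurableT ih)).
move=> /fine_cvgP[_ cl]; rewrite -[LHS](fineK (integrable_fin_num measurableT ih)).
congr EFin; apply: (cvg_unique _ cl) => //.
apply: norm_cvg0.
pose C := 8 * s ^+ 4 * normal_peak s.
apply: (@squeeze_cvgr _ _ _ _ (cst 0) (fun n => (2 * C) * harmonic n)).
- apply: nearW => n; rewrite normr_ge0/= /harmonic/=.
  apply: le_trans (ler_normB _ _) _.
  have -> : 2 * C / n.+1%:R = C / n.+1%:R + C / n.+1%:R by ring.
  by apply: lerD; apply: subXn_pdf_le => //;
    rewrite addrAC subrr add0r ?normrN normr_nat.
- exact: cvg_cst.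
- by rewrite -[X in _ --> X](mulr0 (2 * C)); apply: cvgMr; exact: cvg_harmonic.
Qed.

(** Stein's identity for powers: the derivative of (x - m) ^ k * pdf integrates
    to 0 over the whole line. *)
Lemma normal_moment_rec k : (k <= 3)%N ->
  \int[mu]_x ((x - m) ^+ k.+1 * pdf x) =
  s ^+ 2 * k%:R * \int[mu]_x ((x - m) ^+ k.-1 * pdf x).
Proof.
move=> k3.
have k1 : (k.-1 <= 4)%N by case: k k3 => // k; lia.
have i1 := integrable_subXn_pdf k1.
have i2 := @integrable_subXn_pdf k.+1 k3.
have : \int[mu]_x h k x = 0 by rewrite /Rintegral integral_h0.
rewrite /h RintegralB//.
- rewrite !RintegralZl// => /eqP; rewrite subr_eq0 => /eqP e.
  by rewrite -mulrA e mulrA divff ?mul1r// expf_neq0.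
- exact: (integrableZl measurableT k%:R i1).
- exact: (integrableZl measurableT (s ^- 2) i2).
Qed.

Lemma normal_moments :
  [/\ (normal_prob m s).-integrable [set: R] (fun x => ((x - m) ^+ 4)%:E),
     (normal_prob m s).-integrable [set: R] (fun x => (x - m)%:E),
     (\int[normal_prob m s]_x (x - m)%:E = 0)%E,
     (\int[normal_prob m s]_x ((x - m) ^+ 2)%:E = (s ^+ 2)%:E)%E &
     (\int[normal_prob m s]_x ((x - m) ^+ 4)%:E = (3 * s ^+ 4)%:E)%E].
Proof.
have J0 : \int[mu]_x ((x - m) ^+ 0 * pdf x) = 1.
  rewrite /Rintegral.
  under eq_integral do rewrite expr0 mul1r.
  by rewrite integral_normal_pdf.
have J1 := @normal_moment_rec 0 isT.
have J2 := @normal_moment_rec 1 isT.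
have J4 := @normal_moment_rec 3 isT.
rewrite /= J0 in J2; rewrite /= J2 in J4; rewrite /= mulr0 mul0r in J1.
have mX k : measurable_fun [set: R] (fun x : R => ((x - m) ^+ k)%:E).
  by apply/measurable_EFinP; apply: measurable_funX; exact: measurable_funB.
have E k : (k <= 4)%N -> (\int[mu]_x (((x - m) ^+ k)%:E * (pdf x)%:E) =
    (\int[mu]_x ((x - m) ^+ k * pdf x))%:E)%E.
  move=> k4; rewrite fineK//; apply: integrable_fin_num => //.
  exact: integrable_subXn_pdf.
have i4 : (normal_prob m s).-integrable [set: R] (fun x => ((x - m) ^+ 4)%:E).
  apply/integrableP; split; first exact: mX.
  under eq_integral do rewrite gee0_abs ?lee_fin ?exprn_even_ge0//.
  rewrite ge0_integral_normal_prob//; last first.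
    by move=> x; rewrite lee_fin exprn_even_ge0.
  by rewrite E// ltry.
have i1 : (normal_prob m s).-integrable [set: R] (fun x => (x - m)%:E).
  have ic := finite_measure_integrable_cst (normal_prob m s) 1 measurableT.
  apply: (le_integrable measurableT _ _ (integrableD measurableT ic i4)).
    exact: (mX 1).
  move=> x _; rewrite /= lee_fin [leRHS]ger0_norm; last first.
    by rewrite addr_ge0// exprn_even_ge0.
  by rewrite -[leLHS]expr1 normX_le_X4.
split => //.
- rewrite integral_normal_prob//.
  under eq_integral do rewrite -[X in X%:E]expr1.
  by rewrite E// J1.
- rewrite ge0_integral_normal_prob// ?E// ?J2 ?mulr1//.
  by move=> x; rewrite lee_fin sqr_ge0.
- rewrite ge0_integral_normal_prob// ?E// ?J4.
    by congr EFin; ring.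
  by move=> x; rewrite lee_fin exprn_even_ge0.
Qed.

End NormalMoments.

(** * Second moments of variables with finite fourth moment *)

Section Expectation.
Context {d : measure_display} {T : measurableType d} {R : realType}.
Variable P : probability T R.
Implicit Types (X Y Z : T -> R).

Definition mean X : R := \int[P]_w X w.
(** The inner product of L^2, which is the covariance on centred variables. *)
Definition ip X Y : R := mean (X \* Y).

(** The space L^4 of the probability.  It is stable under linear combinations, and
    the product of two elements, or of their squares, is integrable. *)
Definition L4 X : Prop :=
  measurable_fun [set: T] X /\ P.-integrable [set: T] (fun w => (X w ^+ 4)%:E).

Lemma mean_ae X Y : measurable_fun [set: T] X -> measurable_fun [set: T] Y ->
  {ae P, forall w, X w = Y w} -> mean X = mean Y.
Proof.
move=> mX mY XY; rewrite /mean /Rintegral; congr fine.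
apply: ae_eq_integral => //; [exact/measurable_EFinP|exact/measurable_EFinP|].
by apply: filterS XY => w /= -> _.
Qed.

Lemma sqr_le_X4 (a : R) : a ^+ 2 *+ 2 <= 1 + a ^+ 4.
Proof.
have : 0 <= (a ^+ 2 - 1) ^+ 2 by exact: sqr_ge0.
by rewrite sqrrB1 -exprM mulr2n; lra.
Qed.

(** Up to constants, 1 + x ^ 4 + y ^ 4 dominates every monomial of degree at most 4
    in x and y. *)
Lemma integrable_L4_le X Y Z : measurable_fun [set: T] Z -> L4 X -> L4 Y ->
  (forall w, `|Z w| <= 1 + X w ^+ 4 + Y w ^+ 4) ->
  P.-integrable [set: T] (EFin \o Z).
Proof.
move=> mZ [mX iX] [mY iY] le.
have i1 := finite_measure_integrable_cst P 1 measurableT.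
have i3 := integrableD measurableT (integrableD measurableT i1 iX) iY.
apply: (le_integrable measurableT _ _ i3); first exact/measurable_EFinP.
move=> w _; rewrite /= lee_fin; apply: le_trans (le w) _; exact: ler_norm.
Qed.

Lemma integrable_mul X Y : L4 X -> L4 Y -> P.-integrable [set: T] (EFin \o (X \* Y)).
Proof.
move=> LX LY; apply: (integrable_L4_le _ LX LY).
  by apply: measurable_funM; [case: LX|case: LY].
move=> w /=; have := sqr_le_X4 (X w); have := sqr_le_X4 (Y w).
rewrite ler_norml; have := sqr_ge0 (X w - Y w); have := sqr_ge0 (X w + Y w).
by nra.
Qed.

Lemma integrable_sqrM X Y : L4 X -> L4 Y ->
  P.-integrable [set: T] (EFin \o (fun w => X w ^+ 2 * Y w ^+ 2)).
Proof.
move=> LX LY; apply: (integrable_L4_le _ LX LY).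
  by apply: measurable_funM; apply: measurable_funX; [case: LX|case: LY].
move=> w /=; rewrite ger0_norm; last by apply: mulr_ge0; exact: sqr_ge0.
have := sqr_ge0 (X w ^+ 2 - Y w ^+ 2).
have -> : X w ^+ 4 = X w ^+ 2 * X w ^+ 2 by rewrite -exprD.
have -> : Y w ^+ 4 = Y w ^+ 2 * Y w ^+ 2 by rewrite -exprD.
by nra.
Qed.

Lemma integrable_sqr X : L4 X -> P.-integrable [set: T] (EFin \o (fun w => X w ^+ 2)).
Proof. by move=> LX; have := integrable_mul LX LX. Qed.

Lemma integrable_L4 X : L4 X -> P.-integrable [set: T] (EFin \o X).
Proof.
move=> LX; apply: (integrable_L4_le _ LX LX); first by case: LX.
move=> w /=; have := sqr_le_X4 (X w).
by rewrite ler_norml; have := sqr_ge0 (X w - 1); have := sqr_ge0 (X w + 1); nra.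
Qed.

Lemma L4_ae X Y : L4 X -> measurable_fun [set: T] Y ->
  {ae P, forall w, X w = Y w} -> L4 Y.
Proof.
move=> [mX iX] mY XY; split => //.
apply/integrableP; split.
  by apply/measurable_EFinP; exact: measurable_funX.
case/integrableP : iX => m4; apply: le_lt_trans.
rewrite le_eqVlt; apply/orP; left; apply/eqP.
apply: ae_eq_integral => //.
- apply/measurable_EFinP/measurableT_comp => //; exact: measurable_funX.
- apply/measurable_EFinP/measurableT_comp => //; exact: measurable_funX.
- by apply: filterS XY => w /= -> _.
Qed.

Lemma L4_cst c : L4 (cst c).
Proof. by split => //; exact: (finite_measure_integrable_cst P (c ^+ 4) measurableT). Qed.

Lemma L4Z a X : L4 X -> L4 (a \*o X).
Proof.
move=> [mX iX]; split; first exact: measurable_funM.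
have := integrableZl measurableT (a ^+ 4) iX; apply: eq_integrable => // w _ /=.
by rewrite exprMn.
Qed.

Lemma L4D X Y : L4 X -> L4 Y -> L4 (X \+ Y).
Proof.
move=> [mX iX] [mY iY]; split; first exact: measurable_funD.
have i8X := integrableZl measurableT 8 iX; have i8Y := integrableZl measurableT 8 iY.
have i3 := integrableD measurableT i8X i8Y.
apply: (le_integrable measurableT _ _ i3).
  by apply/measurable_EFinP; apply: measurable_funX; exact: measurable_funD.
move=> w _; rewrite /= lee_fin; apply: le_trans _ (ler_norm _).
rewrite ger0_norm ?exprn_even_ge0//.
have : (X w + Y w) ^+ 4 + (X w - Y w) ^+ 2 * ((X w + Y w) ^+ 2 * 6 + (X w - Y w) ^+ 2)
  = 8 * X w ^+ 4 + 8 * Y w ^+ 4 by ring.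
have : 0 <= (X w - Y w) ^+ 2 * ((X w + Y w) ^+ 2 * 6 + (X w - Y w) ^+ 2).
  apply: mulr_ge0; first exact: sqr_ge0.
  by apply: addr_ge0; [apply: mulr_ge0 => //|]; exact: sqr_ge0.
by lra.
Qed.

Lemma meanD X Y : L4 X -> L4 Y -> mean (X \+ Y) = mean X + mean Y.
Proof. by move=> LX LY; apply: RintegralD => //; exact: integrable_L4. Qed.

Lemma meanZ a X : L4 X -> mean (a \*o X) = a * mean X.
Proof. by move=> LX; apply: RintegralZl => //; exact: integrable_L4. Qed.

Lemma mean_cst c : mean (cst c) = c.
Proof. by have := expectation_cst P c; rewrite unlock /mean /Rintegral => ->. Qed.

Lemma ipC X Y : ip X Y = ip Y X.
Proof. by rewrite /ip; congr mean; apply/funext => w /=; rewrite mulrC. Qed.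

Lemma ipDl X Y Z : L4 X -> L4 Y -> L4 Z -> ip (X \+ Y) Z = ip X Z + ip Y Z.
Proof.
move=> LX LY LZ; rewrite /ip /mean -RintegralD//; try exact: integrable_mul.
by apply: eq_Rintegral => w _ /=; rewrite mulrDl.
Qed.

Lemma ipZl a X Y : L4 X -> L4 Y -> ip (a \*o X) Y = a * ip X Y.
Proof.
move=> LX LY; rewrite /ip /mean -RintegralZl//; try exact: integrable_mul.
by apply: eq_Rintegral => w _ /=; rewrite mulrA.
Qed.

Lemma ip_ael X Y Z : L4 X -> L4 Y -> L4 Z ->
  {ae P, forall w, X w = Y w} -> ip X Z = ip Y Z.
Proof.
move=> [mX _] [mY _] [mZ _] XY; apply: mean_ae; try exact: measurable_funM.
by apply: filterS XY => w /= ->.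
Qed.

Lemma ip_ge0 X : 0 <= ip X X.
Proof. by apply: Rintegral_ge0 => w _ /=; rewrite -expr2 sqr_ge0. Qed.

(** A weak form of the Cauchy-Schwarz inequality, sufficient to bound families of
    inner products uniformly. *)
Lemma ip_norm_le X Y : L4 X -> L4 Y -> `|ip X Y| <= ip X X + ip Y Y.
Proof.
move=> LX LY; have iXX := integrable_mul LX LX; have iYY := integrable_mul LY LY.
have iXY := integrable_mul LX LY.
apply: le_trans (le_normr_Rintegral measurableT iXY) _.
rewrite /ip /mean -RintegralD//.
apply: le_Rintegral => //; first exact: integrable_norm.
  exact: (integrableD measurableT iXX iYY).
move=> w _ /=; rewrite ler_norml.
by have := sqr_ge0 (X w - Y w); have := sqr_ge0 (X w + Y w); nra.
Qed.

End Expectation.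

(** * Laws, independence and Gaussian moments *)

Section Laws.
Context {d : measure_display} {T : measurableType d} {R : realType}.
Variable P : probability T R.
Implicit Types (X Y Z : T -> R).
Local Notation mean := (mean P).
Local Notation ip := (ip P).
Local Notation L4 := (L4 P).

(* the normal laws are measures for the Borel structure measurableTypeR R *)
Section ChangeOfVariables.
Variables (X : T -> R) (nu : {measure set (measurableTypeR R) -> \bar R}).
Hypothesis mX : measurable_fun [set: T] X.
Hypothesis lawX : forall A : set R, measurable A -> P (X @^-1` A) = nu A.

Let mX_mixin := isMeasurableFun.Build _ _ _ (measurableTypeR R) _ mX.
Let X' : {mfun T >-> measurableTypeR R} :=
  MeasurableFun.Pack (MeasurableFun.Class mX_mixin).

Lemma ge0_integral_law (f : measurableTypeR R -> \bar R) :
  measurable_fun [set: measurableTypeR R] f ->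
  (forall x, 0 <= f x)%E -> (\int[P]_w f (X w) = \int[nu]_x f x)%E.
Proof.
move=> mf f0; rewrite -[LHS](ge0_integral_distribution X' mf f0).
by apply: eq_measure_integral => A mA _; exact: lawX.
Qed.

Lemma integrable_law (f : measurableTypeR R -> \bar R) :
  measurable_fun [set: measurableTypeR R] f ->
  nu.-integrable [set: measurableTypeR R] f -> P.-integrable [set: T] (f \o X).
Proof.
move=> mf /integrableP[_ fi]; apply/integrableP; split.
  exact: measurableT_comp.
rewrite (@ge0_integral_law (fun x => `|f x|)%E)//.
exact: measurableT_comp.
Qed.

Lemma integral_law (f : measurableTypeR R -> \bar R) :
  measurable_fun [set: measurableTypeR R] f ->
  nu.-integrable [set: measurableTypeR R] f -> (\int[P]_w f (X w) = \int[nu]_x f x)%E.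
Proof.
move=> mf fi; rewrite -[LHS](integral_distribution (X := X') mf).
  by apply: eq_measure_integral => A mA _; exact: lawX.
exact: integrable_law.
Qed.

End ChangeOfVariables.

(** Both means are the integral of the identity against the common law. *)
Lemma mean_eq_law X Y : measurable_fun [set: T] X -> L4 Y ->
  (forall A : set R, measurable A -> P (X @^-1` A) = P (Y @^-1` A)) ->
  mean X = mean Y.
Proof.
move=> mX LY XY.
have mY : measurable_fun [set: T] Y by case: LY.
pose Y' : {mfun T >-> measurableTypeR R} := MeasurableFun.Pack (MeasurableFun.Class
  (isMeasurableFun.Build _ _ _ (measurableTypeR R) _ mY)).
have iY : P.-integrable [set: T] (EFin \o Y) by exact: integrable_L4.
have iYd : (distribution P Y').-integrable [set: measurableTypeR R]
    (EFin : measurableTypeR R -> \bar R).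
  apply: (@integrable_pushforward _ _ _ _ _ Y') => //.
rewrite /mean /Rintegral; congr fine.
rewrite (@integral_law X (distribution P Y') mX XY EFin)//.
exact: (integral_distribution (X := Y')).
Qed.

(** Independence on events says that the joint law and the product of the
    marginal laws agree on rectangles, hence everywhere; Fubini's theorem then
    factorises the integral of the product. *)
Lemma mean_indep (X Y : {RV P >-> R}) : L4 X -> L4 Y -> indep P X Y ->
  ip X Y = mean X * mean Y.
Proof.
move=> LX LY XY.
pose XYf (w : T) : R * R := (X w, Y w).
have mXY : measurable_fun [set: T] XYf by exact: measurable_fun_pair.
pose XY' : {mfun T >-> (R * R)%type} := MeasurableFun.Pack (MeasurableFun.Class
  (isMeasurableFun.Build _ _ _ _ _ mXY)).
pose f (z : R * R) : \bar R := (z.1 * z.2)%:E.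
have mf : measurable_fun [set: R * R] f.
  by apply/measurable_EFinP; apply: measurable_funM.
have iXY : P.-integrable [set: T] (EFin \o (X \* Y)) by exact: integrable_mul.
have E (A : set (R * R)) : measurable A ->
    (distribution P X \x distribution P Y)%E A = distribution P XY' A.
  by apply: product_measure_unique => B C mB mC; exact: XY.
have if' : ((distribution P X \x distribution P Y)%E).-integrable [set: R * R] f.
  apply/integrableP; split => //.
  rewrite (eq_measure_integral (distribution P XY')); last by move=> A mA _; exact: E.
  rewrite (ge0_integral_distribution XY')//; last exact: measurableT_comp.
  by case/integrableP : iXY.
have -> : ip X Y = fine (\int[distribution P X \x distribution P Y]_z f z)%E.
  rewrite (eq_measure_integral (distribution P XY')); last by move=> A mA _; exact: E.
  by rewrite (integral_distribution (X := XY')).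
rewrite -(integral12_prod_meas1 if').
have iX := integrable_L4 LX; have iY := integrable_L4 LY.
have iYd : (distribution P Y).-integrable [set: R] (EFin : R -> \bar R).
  by apply: (@integrable_pushforward _ _ _ _ _ Y).
have iXd : (distribution P X).-integrable [set: R] (EFin : R -> \bar R).
  by apply: (@integrable_pushforward _ _ _ _ _ X).
have mE (Z : {RV P >-> R}) : L4 Z ->
    (distribution P Z).-integrable [set: R] (EFin : R -> \bar R) ->
    (\int[distribution P Z]_x x%:E = (mean Z)%:E)%E.
  move=> LZ iZ; rewrite (integral_distribution (X := Z))//.
    by rewrite fineK//; exact: integrable_fin_num (integrable_L4 LZ).
  exact: integrable_L4.
under eq_integral => x _.
  rewrite /fubini_F /f /=.
  under eq_integral do rewrite EFinM.
  rewrite integralZl//= mE//.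
  over.
rewrite integralZr// mE//.
Qed.

(** In the nondegenerate case this is normal_moments, where the location is the
    mean; a point mass with mean 0 is concentrated at 0, and the relation between
    the second and fourth moments reads 0 = 0. *)
Lemma gaussian_moments X : measurable_fun [set: T] X -> gaussian P X ->
  L4 X /\ (mean X = 0 -> mean (fun w => X w ^+ 4) = 3 * ip X X ^+ 2).
Proof.
move=> mX [m [s [s0 lawX]]].
have mXn k : measurable_fun [set: R] (fun x : R => (x ^+ k)%:E).
  by apply/measurable_EFinP; exact: measurable_funX.
have mXmn k : measurable_fun [set: R] (fun x : R => ((x - m) ^+ k)%:E).
  by apply/measurable_EFinP; apply: measurable_funX; exact: measurable_funB.
have [seq0|sneq0] := eqVneq s 0.
  have lawX' (A : set R) : measurable A -> P (X @^-1` A) = \d_m A.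
    by move=> mA; rewrite lawX// seq0 eqxx.
  pose dm : {measure set (measurableTypeR R) -> \bar R} := \d_(m : measurableTypeR R).
  have E f : measurable_fun [set: R] (EFin \o f) -> mean (f \o X) = f m.
    move=> mf; rewrite /mean /Rintegral.
    rewrite (@integral_law X dm mX lawX' (EFin \o f))//.
      by rewrite integral_dirac// diracT mul1e.
    apply/integrableP; split => //.
    rewrite integral_dirac//; last exact: measurableT_comp.
    by rewrite diracT mul1e ltry.
  split.
    split => //; apply: (@integrable_law X dm mX lawX' (fun x => (x ^+ 4)%:E) (mXn 4%N)).
    apply/integrableP; split; first exact: (mXn 4%N).
    rewrite integral_dirac//; last exact: (measurableT_comp _ (mXn 4%N)).
    by rewrite diracT mul1e ltry.
  have -> : mean X = m by exact: (E id (mXn 1%N)).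
  have -> : mean (fun w => X w ^+ 4) = m ^+ 4 by exact: (E (fun x => x ^+ 4) (mXn 4)).
  have -> : ip X X = m ^+ 2 by exact: (E (fun x => x ^+ 2) (mXn 2)).
  by move=> ->; rewrite !expr0n/= mulr0.
have lawX' (A : set R) : measurable A -> P (X @^-1` A) = normal_prob m s A.
  by move=> mA; rewrite lawX// (negbTE sneq0).
have [i4 i1 e1 e2 e4] := normal_moments m sneq0.
have LXm : L4 (X \+ cst (- m)).
  split; first exact: measurable_funD.
  by have := @integrable_law X (normal_prob m s) mX lawX' _ (mXmn 4%N) i4.
have LX : L4 X.
  have ae1 : {ae P, forall w, (X \+ cst (- m) \+ cst m) w = X w}.
    by apply: aeW => w /=; rewrite addrNK.
  exact: (L4_ae (L4D LXm (L4_cst P m)) mX ae1).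
split => // mX0.
have m0 : m = 0.
  have : mean (X \+ cst (- m)) = 0.
    rewrite /mean /Rintegral /=.
    rewrite (@integral_law X (normal_prob m s) mX lawX' (fun x => (x - m)%:E)) ?e1//.
      exact: (mXmn 1).
  rewrite meanD ?mean_cst ?mX0//; last exact: L4_cst.
  by rewrite add0r => /eqP; rewrite oppr_eq0 => /eqP.
move: e2 e4; rewrite m0 => e2 e4.
have -> : ip X X = s ^+ 2.
  rewrite /ip /mean /Rintegral.
  rewrite (@ge0_integral_law X (normal_prob m s) mX lawX' (fun x => (x * x)%:E)) ?m0.
  - rewrite -[RHS]/(fine (s ^+ 2)%:E) -e2; congr fine.
    by apply: eq_integral => x _; rewrite subr0.
  - exact: (mXn 2).
  - by move=> x; rewrite lee_fin -expr2 sqr_ge0.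
rewrite /mean /Rintegral.
rewrite (@ge0_integral_law X (normal_prob m s) mX lawX' (fun x => (x ^+ 4)%:E)) ?m0//.
  have -> : 3 * s ^+ 2 ^+ 2 = fine (3 * s ^+ 4)%:E by rewrite /= -exprM.
  by rewrite -e4; congr fine; apply: eq_integral => x _; rewrite subr0.
  exact: (mXn 4%N).
by move=> x; rewrite lee_fin exprn_even_ge0.
Qed.

End Laws.

(** * Convergence in probability *)

Section ConvergenceInProbability.
Context {d : measure_display} {T : measurableType d} {R : realType}.
Variable P : probability T R.

Lemma measurable_deviation (Y : T -> R) (m e : R) :
  measurable_fun [set: T] Y -> measurable [set w | e < `|Y w - m|].
Proof.
move=> mY; rewrite -[X in measurable X]setTI.
have mD : measurable_fun [set: T] (fun w => `|Y w - m|).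
  by apply: measurableT_comp => //; exact: measurable_funB.
by have := mD measurableT _ (measurable_itv `]e, +oo[); rewrite preimage_itvoy.
Qed.

(** A union bound. *)
Lemma cvg_prob_bigU (I : eqType) (s : seq I) (E : I -> nat -> set T) :
  (forall i N, measurable (E i N)) ->
  (forall i, P (E i N) @[N --> \oo] --> 0%E) ->
  P (\big[setU/set0]_(i <- s) E i N) @[N --> \oo] --> 0%E.
Proof.
move=> mE cE; elim: s => [|i s IH].
  by under eq_fun do rewrite big_nil measure0; exact: cvg_cst.
under eq_fun do rewrite big_cons.
apply: (@squeeze_cvge _ _ _ _ (cst 0%E) _
  (fun N => P (E i N) + P (\big[setU/set0]_(i <- s) E i N))%E).
- apply: nearW => N; rewrite measure_ge0/=; apply: measureU2 => //.
  by apply: bigsetU_measurable.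
- exact: cvg_cst.
- by rewrite -[X in _ --> X]adde0; apply: cvgeD.
Qed.

(** The continuous mapping theorem for convergence in probability, in the form
    in which continuity at the limit is a plain epsilon-delta statement. *)
Lemma cvg_in_prob_continuous (I : finType) (X : I -> nat -> T -> R) (l : I -> R)
    (Y : nat -> T -> R) (m : R) :
  (forall i N, measurable_fun [set: T] (X i N)) ->
  (forall N, measurable_fun [set: T] (Y N)) ->
  (forall e, 0 < e -> exists2 del, 0 < del &
     forall N w, (0 < N)%N -> (forall i, `|X i N w - l i| <= del) ->
       `|Y N w - m| <= e) ->
  (forall i, cvg_in_prob P (X i) (l i)) -> cvg_in_prob P Y m.
Proof.
move=> mX mY ctrl cX e e0; have [del del0 H] := ctrl e e0.
have := @cvg_prob_bigU I (index_enum I) (fun i N => [set w | del < `|X i N w - l i|])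
  (fun i N => measurable_deviation (l i) del (mX i N)) (fun i => cX i del del0).
apply: squeeze_cvge; last exact: cvg_cst.
exists 1%N => // N /= N0; rewrite measure_ge0/=; apply: le_measure.
- by rewrite inE; exact: measurable_deviation.
- rewrite inE; apply: bigsetU_measurable => i _; exact: measurable_deviation.
- move=> w /= eY; apply: contrapT => nU; move: eY; rewrite ltNge => /negP; apply.
  apply: H => // i; rewrite leNgt; apply/negP => Hi; apply: nU.
  rewrite -bigcup_seq; exists i => //=.
  by rewrite mem_index_enum.
Qed.

End ConvergenceInProbability.

(** * A law of large numbers for Gaussian processes *)

Section GaussianLLN.
Context {d : measure_display} {T : measurableType d} {R : realType}.
Variable P : probability T R.
Local Notation mean := (mean P).
Local Notation ip := (ip P).
Local Notation L4 := (L4 P).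

(** A linear space of variables with finite fourth moment, stable under almost
    sure equality, on which the only trace of Gaussianity is the kurtosis relation
    E[X ^ 4] = 3 E[X ^ 2] ^ 2. *)
Definition centered_gaussian_space (V : (T -> R) -> Prop) : Prop :=
  [/\ forall X, V X -> L4 X,
      forall X, V X -> mean (fun w => X w ^+ 4) = 3 * ip X X ^+ 2,
      forall X Y, V X -> V Y -> V (X \+ Y),
      forall a X, V X -> V (a \*o X) &
      forall X Y, V X -> measurable_fun [set: T] Y ->
        {ae P, forall w, X w = Y w} -> V Y].

Variable V : (T -> R) -> Prop.
Hypothesis gV : centered_gaussian_space V.

Let VL4 X : V X -> L4 X. Proof. by case: gV => H _ _ _ _; exact: H. Qed.
Let VX4 X : V X -> mean (fun w => X w ^+ 4) = 3 * ip X X ^+ 2.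
Proof. by case: gV => _ H _ _ _; exact: H. Qed.
Let VD X Y : V X -> V Y -> V (X \+ Y).
Proof. by case: gV => _ _ H _ _; exact: H. Qed.
Let VZ a X : V X -> V (a \*o X).
Proof. by case: gV => _ _ _ H _; exact: H. Qed.

Lemma ip_lincomb2 a b X Y X' Y' : L4 X -> L4 Y -> L4 X' -> L4 Y' ->
  ip (a \*o X \+ b \*o Y) (a \*o X' \+ b \*o Y') =
  a ^+ 2 * ip X X' + a * b * (ip X Y' + ip Y X') + b ^+ 2 * ip Y Y'.
Proof.
move=> LX LY LX' LY'; have LaX := L4Z a LX'; have LbY := L4Z b LY'.
have LS := L4D LaX LbY.
rewrite ipDl ?ipZl//; try exact: L4Z.
rewrite (ipC P X) (ipC P Y) !ipDl ?ipZl//.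
by rewrite (ipC P X' X) (ipC P Y' X) (ipC P X' Y) (ipC P Y' Y); ring.
Qed.

(** The instance of Isserlis' theorem for squares, obtained by polarisation of
    the fourth moments of A + B and A - B. *)
Lemma isserlis_sqr A B : V A -> V B ->
  mean (fun w => A w ^+ 2 * B w ^+ 2) = ip A A * ip B B + 2 * ip A B ^+ 2.
Proof.
move=> VA VB; have LA := VL4 VA; have LB := VL4 VB.
pose S := 1 \*o A \+ 1 \*o B; pose D := 1 \*o A \+ (-1) \*o B.
have VS : V S by apply: VD; exact: VZ.
have VDD : V D by apply: VD; exact: VZ.
have i4 X : V X -> P.-integrable [set: T] (EFin \o (fun w => X w ^+ 4)).
  by move=> VX; case: (VL4 VX).
have iAB := integrable_sqrM LA LB.
have e1 : mean (fun w => S w ^+ 4 + D w ^+ 4) =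
    mean (fun w => S w ^+ 4) + mean (fun w => D w ^+ 4).
  by rewrite /mean RintegralD//; exact: i4.
have e2 : mean (fun w => 2 * A w ^+ 4 + (2 * B w ^+ 4 + 12 * (A w ^+ 2 * B w ^+ 2))) =
    2 * mean (fun w => A w ^+ 4) +
    (2 * mean (fun w => B w ^+ 4) + 12 * mean (fun w => A w ^+ 2 * B w ^+ 2)).
  have j1 := integrableZl measurableT 2 (i4 _ VA).
  have j2 := integrableZl measurableT 2 (i4 _ VB).
  have j3 := integrableZl measurableT 12 iAB.
  have i4A := i4 _ VA; have i4B := i4 _ VB.
  rewrite /mean RintegralD//; last exact: (integrableD measurableT j2 j3).
  by rewrite RintegralD// !RintegralZl//.
have : mean (fun w => S w ^+ 4 + D w ^+ 4) =
   mean (fun w => 2 * A w ^+ 4 + (2 * B w ^+ 4 + 12 * (A w ^+ 2 * B w ^+ 2))).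
  by apply: eq_Rintegral => w _; rewrite /S /D /=; ring.
rewrite e1 e2 !VX4// !ip_lincomb2// (ipC P B A).
move=> H; apply: (@mulfI _ 12) => //; move: H.
set a := ip A A; set b := ip B B; set c := ip A B; set m := mean _.
move=> H; have -> : 12 * m = (2 * (3 * a ^+ 2) + (2 * (3 * b ^+ 2) + 12 * m)) -
  2 * (3 * a ^+ 2) - 2 * (3 * b ^+ 2) by ring.
by rewrite -H; ring.
Qed.

Lemma mean_sum (I : Type) (s : seq I) (f : I -> T -> R) :
  (forall i, P.-integrable [set: T] (EFin \o f i)) ->
  mean (fun w => \sum_(i <- s) f i w) = \sum_(i <- s) mean (f i).
Proof.
move=> If; elim: s => [|i s IH].
  by rewrite big_nil -[RHS](mean_cst P 0); apply: eq_Rintegral => w _; rewrite big_nil.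
rewrite big_cons -IH.
have -> : mean (fun w => \sum_(j <- i :: s) f j w) =
          mean (fun w => f i w + \sum_(j <- s) f j w).
  by apply: eq_Rintegral => w _; rewrite big_cons.
rewrite /mean RintegralD//.
have := @integrable_sum _ _ _ P _ measurableT _ s xpredT (fun i => EFin \o f i)
  (fun i _ => If i).
by apply: eq_integrable => // w _; rewrite /= sumEFin.
Qed.

(** Convergence to 0 at both ends of the integers. *)
Definition vanishing (g : int -> R) : Prop :=
  forall e, 0 < e -> exists M : nat, forall z : int, (M <= `|z|)%N -> `|g z| <= e.

(** In a row of a Toeplitz array each lag occurs at most twice. *)
Lemma sum_toeplitz_le (k : nat -> R) (N s : nat) : (forall i, 0 <= k i) ->
  (1 <= s < N.+1)%N ->
  \sum_(1 <= t < N.+1) k `|s%:Z - t%:Z|%N <= 2 * \sum_(0 <= i < N) k i.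
Proof.
move=> k0 /andP[s1 sN].
have sub a : (a <= N)%N -> \sum_(0 <= i < a) k i <= \sum_(0 <= i < N) k i.
  by move=> aN; rewrite (big_cat_nat _ aN)//= lerDl sumr_ge0.
rewrite (big_cat_nat s1 (ltnW sN))/= mulr2n mulrDl !mul1r; apply: lerD.
- rewrite big_nat_rev/=; apply: le_trans (sub s _); last by rewrite -ltnS.
  rewrite [leRHS](big_cat_nat (n := 1))//= -[leLHS]add0r; apply: lerD.
    by rewrite sumr_ge0.
  rewrite big_nat_cond [leRHS]big_nat_cond le_eqVlt; apply/orP; left; apply/eqP.
  by apply: eq_bigr => t /andP[/andP[t1 ts] _]; congr k; lia.
- rewrite -{1}[s]add0n big_addn; apply: le_trans (sub (N.+1 - s)%N _); last by lia.
  rewrite big_nat_cond [leRHS]big_nat_cond le_eqVlt; apply/orP; left; apply/eqP.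
  by apply: eq_bigr => t _; congr k; lia.
Qed.

Section Squares.
Variables (Z : int -> T -> R) (g : int -> R).
Hypothesis VZt : forall t, V (Z t).
Hypothesis ipZ : forall s t, ip (Z s) (Z t) = g (s - t).
Hypothesis g0 : vanishing g.

Let Y (t : nat) (w : T) : R := Z t%:Z w ^+ 2 - g 0.

Let mZ t : measurable_fun [set: T] (Z t).
Proof. by case: (VL4 (VZt t)). Qed.

Let meanYY s t : mean (fun w => Y s w * Y t w) = 2 * g (s%:Z - t%:Z) ^+ 2.
Proof.
have LA := VL4 (VZt s); have LB := VL4 (VZt t).
have iAB := integrable_sqrM LA LB.
have iA := integrable_sqr LA; have iB := integrable_sqr LB.
have ic := finite_measure_integrable_cst P (g 0 ^+ 2) measurableT.
have iA' := integrableZl measurableT (- g 0) iA.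
have iB' := integrableZl measurableT (- g 0) iB.
have -> : mean (fun w => Y s w * Y t w) =
  mean (fun w => Z s w ^+ 2 * Z t w ^+ 2 + (- g 0 * Z s w ^+ 2 + (- g 0 * Z t w ^+ 2
    + cst (g 0 ^+ 2) w))).
  by apply: eq_Rintegral => w _; rewrite /Y /=; ring.
have j1 := integrableD measurableT iB' ic.
have j2 := integrableD measurableT iA' j1.
rewrite /mean RintegralD// RintegralD// RintegralD// !RintegralZl//.
rewrite -!/(mean _) mean_cst isserlis_sqr// !ipZ.
have e2 r : mean (fun w => Z r w ^+ 2) = g 0 by rewrite -(subrr r) -ipZ.
rewrite !e2 !subrr; first by ring.
exact: finite_measure_integrable_cst.
Qed.

Let iYY s t : P.-integrable [set: T] (EFin \o (fun w => Y s w * Y t w)).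
Proof.
have L s' : L4 (Z s') := VL4 (VZt s').
have iAB := integrable_sqrM (L s) (L t).
have ic := finite_measure_integrable_cst P (g 0 ^+ 2) measurableT.
have iA' := integrableZl measurableT (- g 0) (integrable_sqr (L s)).
have iB' := integrableZl measurableT (- g 0) (integrable_sqr (L t)).
have i3 := integrableD measurableT iA' (integrableD measurableT iB' ic).
have := integrableD measurableT iAB i3.
apply: eq_integrable => // w _ /=.
by rewrite -!EFinM -!EFinD /Y; congr EFin; ring.
Qed.

Let S (N : nat) (w : T) : R := \sum_(1 <= t < N.+1) Y t w.

Let mS N : measurable_fun [set: T] (S N).
Proof.
apply: measurable_sum => t; apply: measurable_funB => //.
exact: measurable_funX.
Qed.

Let g2 (n : nat) : R := g n%:Z ^+ 2.

Let g_sym (z : int) : g z = g (- z).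
Proof. by rewrite -[z]subr0 -ipZ ipC ipZ sub0r subr0. Qed.

Let g_abs (z : int) : g z ^+ 2 = g2 `|z|%N.
Proof. by rewrite /g2; case: (intP z) => // n; rewrite abszN -g_sym. Qed.

Let SSE N w : S N w ^+ 2 =
  \sum_(p <- [seq (s, t) | s <- index_iota 1 N.+1, t <- index_iota 1 N.+1])
     Y p.1 w * Y p.2 w.
Proof.
rewrite big_allpairs /S expr2 mulr_suml.
by apply: eq_bigr => s _; rewrite mulr_sumr.
Qed.

Let iSS N : P.-integrable [set: T] (EFin \o (fun w => S N w ^+ 2)).
Proof.
have := @integrable_sum _ _ _ P _ measurableT _
  [seq (s, t) | s <- index_iota 1 N.+1, t <- index_iota 1 N.+1] xpredT
  (fun p => EFin \o (fun w => Y p.1 w * Y p.2 w)) (fun p _ => iYY p.1 p.2).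
by apply: eq_integrable => // w _; rewrite /= SSE sumEFin.
Qed.

(** The covariances of the squares form a Toeplitz array, see sum_toeplitz_le. *)
Let meanSS N : mean (fun w => S N w ^+ 2) <= 4 * N%:R * \sum_(0 <= i < N) g2 i.
Proof.
have -> : mean (fun w => S N w ^+ 2) =
    \sum_(1 <= s < N.+1) \sum_(1 <= t < N.+1) mean (fun w => Y s w * Y t w).
  under [mean _]eq_Rintegral do rewrite SSE.
  by rewrite -/(mean _) (mean_sum _ (f := fun p w => Y p.1 w * Y p.2 w)) ?big_allpairs.
apply: (@le_trans _ _ (\sum_(1 <= s < N.+1) 4 * \sum_(0 <= i < N) g2 i)).
  rewrite big_nat_cond [leRHS]big_nat_cond; apply: ler_sum => s /andP[sN _].
  under eq_bigr do rewrite meanYY g_abs.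
  rewrite -mulr_sumr (_ : 4 = 2 * 2); last by ring.
  rewrite -mulrA ler_pM2l//; apply: sum_toeplitz_le => // i; exact: sqr_ge0.
by rewrite sumr_const_nat subn1/= -[leLHS]mulr_natl mulrA (mulrC N%:R).
Qed.

(** By Chebyshev's inequality, since the variance of the time average is at most
    four times the Cesaro mean of the squared autocovariances. *)
Lemma cvg_in_prob_sqr :
  cvg_in_prob P (fun N w => (\sum_(1 <= t < N.+1) Z t%:Z w ^+ 2) / N%:R) (g 0).
Proof.
move=> e e0; pose A N := [set w | e < `|(\sum_(1 <= t < N.+1) Z t%:Z w ^+ 2) / N%:R - g 0|].
suff : P (A n.+1) @[n --> \oo] --> 0%E by rewrite (@cvg_shiftS _ (fun N => P (A N))).
pose b n : R := 4 / e ^+ 2 * arithmetic_mean g2 n.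
apply: (@squeeze_cvge _ _ _ _ (cst 0%E) _ (EFin \o b)).
- apply: nearW => n; rewrite measure_ge0/=.
  have N0 : 0 < n.+1%:R :> R by rewrite ltr0n.
  pose SX : {mfun T >-> R} := MeasurableFun.Pack (MeasurableFun.Class
    (isMeasurableFun.Build _ _ _ _ _ (mS n.+1))).
  have e'0 : 0 < n.+1%:R * e by rewrite mulr_gt0.
  have := @markov _ _ _ P SX (fun x => x ^+ 2) _ e'0.
  have -> : ('E_P[((fun x : R => (x ^+ 2)%R) \o Num.Def.normr) \o SX] =
      (mean (fun w => S n.+1 w ^+ 2)%R)%:E)%E.
    rewrite unlock /mean /Rintegral fineK; last exact: integrable_fin_num (iSS n.+1).
    by apply: eq_integral => w _ /=; rewrite real_normK// num_real.
  have mono : {in Num.nneg &, {homo (fun x : R => x ^+ 2) : x y / x <= y}}.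
    by move=> x y; rewrite !nnegrE => x0 y0; rewrite ler_sqr.
  move=> /(_ (exprn_measurable _) (fun r _ => sqr_ge0 r) mono) H.
  have sub : A n.+1 `<=` [set x | ((n.+1%:R * e)%:E <= `|(SX x)%:E|)%E].
    move=> w; rewrite /A/= lee_fin => /ltW eA.
    apply: (@le_trans _ _ (n.+1%:R * `|(\sum_(1 <= t < n.+2) Z t w ^+ 2) / n.+1%:R - g 0|)).
      by rewrite ler_pM2l.
    rewrite -[X in X * _](ger0_norm (ltW N0)) -normrM le_eqVlt; apply/orP; left.
    apply/eqP; congr (`| _ |); rewrite /S sumrB mulrBr mulrCA divff ?gt_eqF// mulr1.
    by rewrite sumr_const_nat subn1 mulr_natl.
  have mB : measurable [set x | ((n.+1%:R * e)%:E <= `|(SX x)%:E|)%E].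
    rewrite -[X in measurable X]setTI; apply: emeasurable_fun_c_infty => //.
    by apply: measurableT_comp => //; apply/measurable_EFinP; exact: mS.
  have : (P (A n.+1) <= P [set x | ((n.+1%:R * e)%:E <= `|(SX x)%:E|)%E])%E.
    apply: le_measure => //; rewrite inE//.
    apply: measurable_deviation; apply: measurable_funM => //.
    by apply: measurable_sum => t; exact: measurable_funX.
  move=> /le_trans; apply.
  rewrite -(@lee_pmul2l _ ((n.+1%:R * e) ^+ 2)%:E)//; last by rewrite lte_fin exprn_gt0.
  apply: le_trans H _; rewrite -EFinM lee_fin.
  apply: le_trans (meanSS _) _.
  rewrite /b /arithmetic_mean /series/= le_eqVlt; apply/orP; left; apply/eqP.
  by field; rewrite !gt_eqF.
- exact: cvg_cst.
- rewrite -[X in _ --> X]/((0:R)%:E) -(mulr0 (4 / e ^+ 2)).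
  apply: cvg_EFin; first by apply: nearW.
  apply: cvgMr; apply: cesaro.
  rewrite -[X in _ --> X](mulr0 (0 : R)).
  have cg : g n%:Z @[n --> \oo] --> (0 : R).
    apply/cvgrPdist_le => r r0; have [M HM] := g0 r0.
    by exists M => // n /= Mn; rewrite sub0r normrN; exact: HM.
  rewrite (_ : g2 = (fun n : nat => g n%:Z * g n%:Z)); first exact: cvgM.
  by apply/funext => n; rewrite /g2 expr2.
Qed.

End Squares.

(** Joint second-order stationarity with a cross-covariance function that tends
    to 0 at large lags. *)
Definition decorrelating (A B : int -> T -> R) : Prop :=
  exists2 g, (forall s t, ip (A s) (B t) = g (s - t)) & vanishing g.

Lemma vanishingD g1 g2 : vanishing g1 -> vanishing g2 -> vanishing (fun z => g1 z + g2 z).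
Proof.
move=> v1 v2 e e0; have e20 : 0 < e / 2 by rewrite divr_gt0.
have [M1 H1] := v1 _ e20; have [M2 H2] := v2 _ e20.
exists (maxn M1 M2) => z; rewrite geq_max => /andP[z1 z2].
rewrite (splitr e); apply: le_trans (ler_normD _ _) _.
by apply: lerD; [apply: H1|apply: H2].
Qed.

Lemma vanishingZ a g : vanishing g -> vanishing (fun z => a * g z).
Proof.
move=> v e e0; have c0 : 0 < `|a| + 1 by rewrite ltr_pwDr.
have [M H] := v (e / (`|a| + 1)) (divr_gt0 e0 c0).
exists M => z /H; rewrite ler_pdivlMr// normrM => h.
by apply: le_trans h; rewrite mulrC ler_wpM2l// lerDl.
Qed.

Lemma vanishing_shift g h : vanishing g -> vanishing (fun z => g (z + h)).
Proof.
move=> v e e0; have [M H] := v e e0.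
by exists (M + `|h|)%N => z zM; apply: H; lia.
Qed.

Lemma vanishingN g : vanishing g -> vanishing (fun z => g (- z)).
Proof.
by move=> v e e0; have [M H] := v e e0; exists M => z zM; apply: H; rewrite abszN.
Qed.

Lemma decorrelatingC A B : decorrelating A B -> decorrelating B A.
Proof.
move=> [g ABg vg]; exists (fun z => g (- z)); last exact: vanishingN.
by move=> s t; rewrite ipC ABg opprB.
Qed.

(** Polarisation: A B = ((A + B) ^ 2 - (A - B) ^ 2) / 4. *)
Lemma cvg_in_prob_mul (A B : int -> T -> R) :
  (forall t, V (A t)) -> (forall t, V (B t)) ->
  decorrelating A A -> decorrelating A B -> decorrelating B B ->
  cvg_in_prob P (fun N w => (\sum_(1 <= t < N.+1) A t%:Z w * B t%:Z w) / N%:R)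
    (ip (A 0) (B 0)).
Proof.
move=> VA VB [gA hA vA] [g hAB v] [gB hB vB].
pose C (b : bool) (t : int) : T -> R := 1 \*o A t \+ (if b then 1 else -1) \*o B t.
pose gC (b : bool) z := gA z + ((if b then 1 else -1) * (g z + g (- z)) + gB z).
have VC b t : V (C b t) by apply: VD; exact: VZ.
have cvgC b := @cvg_in_prob_sqr (C b) (gC b) (VC b).
have {}cvgC b : cvg_in_prob P
    (fun N w => (\sum_(1 <= t < N.+1) C b t%:Z w ^+ 2) / N%:R) (gC b 0).
  apply: cvgC.
    move=> s t; rewrite /C ip_lincomb2; try by apply: VL4.
    rewrite hA hB hAB (ipC P (B s)) (hAB t s) /gC opprB.
    by case: b; ring.
  apply: vanishingD => //; apply: vanishingD => //; apply: vanishingZ.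
  by apply: vanishingD => //; exact: vanishingN.
have mA t : measurable_fun [set: T] (A t) by case: (VL4 (VA t)).
have mB t : measurable_fun [set: T] (B t) by case: (VL4 (VB t)).
have mC b t : measurable_fun [set: T] (C b t) by case: (VL4 (VC b t)).
apply: (cvg_in_prob_continuous _ _ _ cvgC).
- move=> b N; apply: measurable_funM => //.
  by apply: measurable_sum => t; exact: measurable_funX.
- move=> N; apply: measurable_funM => //.
  by apply: measurable_sum => t; exact: measurable_funM.
- move=> e e0; exists e => // N w N0 H.
  have -> : (\sum_(1 <= t < N.+1) A t%:Z w * B t%:Z w) / N%:R - ip (A 0) (B 0) =
    (((\sum_(1 <= t < N.+1) C true t%:Z w ^+ 2) / N%:R - gC true 0) -
    ((\sum_(1 <= t < N.+1) C false t%:Z w ^+ 2) / N%:R - gC false 0)) / 4.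
    have -> : \sum_(1 <= t < N.+1) A t%:Z w * B t%:Z w =
       (\sum_(1 <= t < N.+1) C true t%:Z w ^+ 2 -
        \sum_(1 <= t < N.+1) C false t%:Z w ^+ 2) / 4.
      by rewrite -sumrB mulr_suml; apply: eq_bigr => t _; rewrite /C/=; field.
    by rewrite hAB subrr /gC oppr0; field; rewrite pnatr_eq0 -lt0n.
  have := H true; have := H false.
  set a := _ / N%:R - _; set b := _ / N%:R - _ => ha hb.
  rewrite normrM (ger0_norm (_ : 0 <= 4^-1)) ?invr_ge0// ler_pdivrMr//.
  by apply: le_trans (ler_normB _ _) _; lra.
Qed.

(** Finite moving averages of the family W, up to almost sure equality.  The
    response, the regressors and their lags all belong to this class, whereas the
    autocovariances need only be computed for W. *)
Inductive filtered (J : Type) (W : J -> int -> T -> R) : (int -> T -> R) -> Prop :=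
| filtered_base j : filtered W (W j)
| filtered_add A B : filtered W A -> filtered W B -> filtered W (fun t => A t \+ B t)
| filtered_scale a A : filtered W A -> filtered W (fun t => a \*o A t)
| filtered_shift h A : filtered W A -> filtered W (fun t => A (t + h))
| filtered_ae A B : filtered W A -> (forall t, measurable_fun [set: T] (B t)) ->
    (forall t, {ae P, forall w, A t w = B t w}) -> filtered W B.

Section Filtered.
Variables (J : Type) (W : J -> int -> T -> R).
Hypothesis VW : forall j t, V (W j t).
Hypothesis decW : forall j k, decorrelating (W j) (W k).

Lemma filtered_space A : filtered W A -> forall t, V (A t).
Proof.
elim=> [j|A1 A2 _ IH1 _ IH2|a A1 _ IH|h A1 _ IH|A1 A2 _ IH mA2 A12] t.
- exact: VW.
- exact: VD.
- exact: VZ.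
- exact: IH.
- by case: gV => _ _ _ _ H; exact: (H (A1 t)).
Qed.

Lemma filtered_decorrelatingl A B : (forall j, decorrelating (W j) B) ->
  (forall t, V (B t)) -> filtered W A -> decorrelating A B.
Proof.
move=> decB VB; have LB t := VL4 (VB t).
elim=> [j|A1 A2 fA1 [g1 e1 v1] fA2 [g2 e2 v2]|a A1 fA1 [g1 e1 v1]|h A1 fA1 [g1 e1 v1]
  |A1 A2 fA1 [g1 e1 v1] mA2 A12].
- exact: decB.
- exists (fun z => g1 z + g2 z); last exact: vanishingD.
  by move=> s t; rewrite ipDl ?e1 ?e2//; apply: VL4; exact: filtered_space.
- exists (fun z => a * g1 z); last exact: vanishingZ.
  by move=> s t; rewrite ipZl ?e1//; apply: VL4; exact: filtered_space.
- exists (fun z => g1 (z + h)); last exact: vanishing_shift.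
  by move=> s t; rewrite e1; congr g1; ring.
- exists g1 => // s t; rewrite -e1; apply/esym; apply: ip_ael => //.
  + by apply: VL4; exact: filtered_space.
  + by apply: VL4; apply: filtered_space; exact: (filtered_ae fA1).
Qed.

Lemma filtered_decorrelating A B : filtered W A -> filtered W B -> decorrelating A B.
Proof.
move=> fA fB; apply: filtered_decorrelatingl => //; last exact: filtered_space.
move=> j; apply: decorrelatingC; apply: filtered_decorrelatingl => //.
Qed.

(** Every sample moment of the two regressions is of this form. *)
Lemma cvg_in_prob_filtered A B : filtered W A -> filtered W B ->
  cvg_in_prob P (fun N w => (\sum_(1 <= t < N.+1) A t%:Z w * B t%:Z w) / N%:R)
    (ip (A 0) (B 0)).
Proof.
move=> fA fB; apply: cvg_in_prob_mul; try exact: filtered_space;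
  exact: filtered_decorrelating.
Qed.

End Filtered.

End GaussianLLN.

(** * Least squares *)

Section LeastSquaresAlgebra.
Context {R : realType} {m : nat}.
Variables (X : 'I_m -> nat -> R) (Y : nat -> R) (N : nat).

Definition lsq (b : 'cV[R]_m) : R :=
  \sum_(1 <= t < N.+1) (Y t - \sum_k b k 0 * X k t) ^+ 2.

Definition gram : 'M[R]_m := \matrix_(k, l) \sum_(1 <= t < N.+1) X k t * X l t.

Definition cross : 'cV[R]_m := \col_k \sum_(1 <= t < N.+1) X k t * Y t.

Lemma gram_mulmx (h : 'cV[R]_m) k :
  (gram *m h) k 0 = \sum_(1 <= t < N.+1) X k t * \sum_l h l 0 * X l t.
Proof.
rewrite mxE; under eq_bigr do rewrite mxE mulr_suml.
rewrite exchange_big /=; apply: eq_bigr => t _; rewrite mulr_sumr.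
by apply: eq_bigr => l _; ring.
Qed.

(** Pythagoras: by the normal equations the residuals at b are orthogonal to every
    linear combination of the regressors. *)
Lemma lsqD (b h : 'cV[R]_m) : gram *m b = cross ->
  lsq (b + h) = lsq b + \sum_(1 <= t < N.+1) (\sum_k h k 0 * X k t) ^+ 2.
Proof.
move=> normal.
have orth : \sum_(1 <= t < N.+1)
    (Y t - \sum_k b k 0 * X k t) * (\sum_k h k 0 * X k t) = 0.
  under eq_bigr do rewrite mulr_sumr.
  rewrite exchange_big /= big1// => k _.
  have := congr1 (fun c : 'cV_m => c k 0) normal; rewrite /= gram_mulmx mxE => /eqP.
  rewrite -subr_eq0 -sumrB => /eqP nk.
  apply: (@eq_trans _ _ (- h k 0 * 0)); last by rewrite mulr0.
  rewrite -[X in _ = _ * X]nk [RHS]mulr_sumr.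
  by apply: eq_bigr => t _; ring.
apply: (@eq_trans _ _ (lsq b - 2 * 0 + \sum_(1 <= t < N.+1) (\sum_k h k 0 * X k t) ^+ 2));
  last by rewrite mulr0 subr0.
rewrite -[X in _ * X]orth -mulNr [X in _ + X + _]mulr_sumr /lsq.
rewrite -!big_split /=; apply: eq_bigr => t _.
have -> : \sum_k (b + h) k 0 * X k t =
    \sum_k b k 0 * X k t + \sum_k h k 0 * X k t.
  by rewrite -big_split /=; apply: eq_bigr => k _; rewrite mxE mulrDl.
by ring.
Qed.

Lemma lsq_unique_minimizer : gram \in unitmx ->
  exists b, [/\ gram *m b = cross, forall b', lsq b <= lsq b' &
    forall b', lsq b' <= lsq b -> b' = b].
Proof.
move=> uG; exists (invmx gram *m cross).
have normal : gram *m (invmx gram *m cross) = cross by rewrite mulKVmx.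
set b := invmx gram *m cross in normal *.
split => // b'.
  rewrite -(subrK b b') addrC lsqD// lerDl sumr_ge0// => t _; exact: sqr_ge0.
rewrite -{1}(subrK b b') addrC lsqD//; set h := b' - b => le0.
have h0 t : t \in index_iota 1 N.+1 -> \sum_k h k 0 * X k t = 0.
  move=> tN; apply/eqP; rewrite -sqrf_eq0.
  have s0 : \sum_(1 <= t < N.+1) (\sum_k h k 0 * X k t) ^+ 2 == 0.
    rewrite eq_le sumr_ge0 ?andbT => [|? _]; last exact: sqr_ge0.
    by move: le0; rewrite -[leRHS]addr0 lerD2l.
  move: s0; rewrite psumr_eq0 => [|? _]; last exact: sqr_ge0.
  by move=> /allP /(_ t tN).
apply/eqP; rewrite -subr_eq0 -/h; apply/eqP.
rewrite -(mulKmx uG h) (_ : gram *m h = 0) ?mulmx0//.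
apply/matrixP => k j; rewrite (ord1 j) gram_mulmx mxE big_nat_cond big1// => t.
by rewrite andbT => tN; rewrite h0 ?mulr0// mem_index_iota.
Qed.

End LeastSquaresAlgebra.

Lemma unitmx_injective (R : fieldType) (m : nat) (M : 'M[R]_m) :
  (forall h : 'cV[R]_m, M *m h = 0 -> h = 0) -> M \in unitmx.
Proof.
move=> inj; rewrite -unitmx_tr -row_free_unit; apply: inj_row_free => u uM.
apply: trmx_inj; rewrite trmx0; apply: inj.
by rewrite -[M]trmxK -trmx_mul uM trmx0.
Qed.

(** Solutions of a linear system depend continuously on the system near an
    invertible matrix; the estimate w = M^-1 (S w) - M^-1 ((S - M) w) gives both
    the invertibility of S and the bound on the solution. *)
Lemma linear_system_continuous {R : realType} {m : nat} (M : 'M[R]_m)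
    (v theta : 'cV[R]_m) (e : R) :
  M \in unitmx -> M *m theta = v -> 0 < e ->
  exists2 del, 0 < del & forall (S : 'M[R]_m) (c : 'cV[R]_m),
    (forall k l, `|S k l - M k l| <= del) -> (forall k, `|c k 0 - v k 0| <= del) ->
    S \in unitmx /\ forall b : 'cV[R]_m, S *m b = c ->
      forall k, `|b k 0 - theta k 0| <= e.
Proof.
move=> uM Mtheta e0.
pose nrm (w : 'cV[R]_m) : R := \sum_k `|w k 0|.
pose K : R := \sum_k \sum_l `|invmx M k l|.
have nrm0 w : 0 <= nrm w by exact: sumr_ge0.
have K0 : 0 <= K by apply: sumr_ge0 => k _; exact: sumr_ge0.
have core (S : 'M[R]_m) (w : 'cV[R]_m) (r del : R) :
    (forall k l, `|S k l - M k l| <= del) ->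
    (forall k, `|(S *m w) k 0| <= r) -> nrm w <= K * (r + del * nrm w).
  move=> HS Hr.
  have ew : w = invmx M *m (S *m w - (S - M) *m w).
    by rewrite mulmxBl opprB addrCA subrr addr0 mulKmx.
  have entry l : `|(S *m w - (S - M) *m w) l 0| <= r + del * nrm w.
    have -> : (S *m w - (S - M) *m w) l 0 = (S *m w) l 0 - ((S - M) *m w) l 0.
      by rewrite [LHS]mxE [X in _ + X = _]mxE.
    apply: le_trans (ler_normB _ _) _; apply: lerD; first exact: Hr.
    rewrite mxE; apply: le_trans (ler_norm_sum _ _ _) _.
    rewrite /nrm mulr_sumr; apply: ler_sum => k _; rewrite normrM !mxE.
    exact: ler_wpM2r.
  rewrite {1}ew /nrm /K mulr_suml; apply: ler_sum => k _; rewrite mxE.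
  apply: le_trans (ler_norm_sum _ _ _) _; rewrite mulr_suml.
  by apply: ler_sum => l _; rewrite normrM; apply: ler_wpM2l.
pose B := 2 * (K + 1) * (1 + nrm theta).
have K10 : 0 < K + 1 by apply: ltr_wpDl.
have n10 : 0 < 1 + nrm theta by apply: ltr_pwDl.
have B0 : 0 < B by rewrite /B !mulr_gt0.
pose del : R := Num.min (2 * (K + 1))^-1 (e / B).
have del0 : 0 < del by rewrite lt_min invr_gt0 divr_gt0// mulr_gt0.
have Kdel : K * del <= 2^-1.
  apply: (@le_trans _ _ ((K + 1) * (2 * (K + 1))^-1)); last first.
    by rewrite le_eqVlt; apply/orP; left; apply/eqP; field; rewrite gt_eqF.
  apply: ler_pM => //; first exact: ltW.
    by rewrite lerDl.
  by rewrite ge_min lexx.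
have absorb w (r : R) : 0 <= r -> nrm w <= K * (r + del * nrm w) -> nrm w <= 2 * K * r.
  move=> r0; rewrite mulrDr mulrA => h.
  have := ler_wpM2r (nrm0 w) Kdel; lra.
exists del => // S c HS Hc; split.
  apply: unitmx_injective => h Sh.
  have nh : nrm h <= 0.
    have := absorb h 0 (lexx 0); rewrite mulr0; apply.
    by apply: (core S) => // k; rewrite Sh mxE normr0.
  apply/matrixP => k i; rewrite (ord1 i) [RHS]mxE; apply/eqP; rewrite -normr_eq0.
  have : nrm h == 0 by rewrite eq_le nh nrm0.
  by rewrite psumr_eq0// => /allP /(_ k (mem_index_enum k)).
move=> b Sb k.
pose w := b - theta.
have Sw l : `|(S *m w) l 0| <= del * (1 + nrm theta).
  have -> : S *m w = (c - v) - (S - M) *m theta.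
    by rewrite /w mulmxBr Sb mulmxBl Mtheta; apply/matrixP => i j; rewrite !mxE; ring.
  have -> : (c - v - (S - M) *m theta) l 0 = c l 0 - v l 0 - ((S - M) *m theta) l 0.
    by rewrite [LHS]mxE [X in X + _ = _]mxE [X in _ + X + _ = _]mxE [X in _ + X = _]mxE.
  apply: le_trans (ler_normB _ _) _; rewrite mulrDr mulr1; apply: lerD => //.
  rewrite mxE; apply: le_trans (ler_norm_sum _ _ _) _.
  rewrite /nrm mulr_sumr; apply: ler_sum => j _; rewrite normrM !mxE.
  exact: ler_wpM2r.
have nw : nrm w <= 2 * K * (del * (1 + nrm theta)).
  apply: absorb; last exact: (core S).
  by rewrite mulr_ge0 ?(ltW del0)// addr_ge0.
apply: (@le_trans _ _ (nrm w)).
  have -> : b k 0 - theta k 0 = w k 0 by rewrite !mxE.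
  by rewrite /nrm (bigD1 k)//= lerDl sumr_ge0.
apply: le_trans nw _.
apply: (@le_trans _ _ (B * (e / B))); last by rewrite mulrC divfK// gt_eqF.
have -> : 2 * K * (del * (1 + nrm theta)) = (2 * K * (1 + nrm theta)) * del by ring.
apply: ler_pM; rewrite ?(ltW del0)//.
- by rewrite mulr_ge0 ?addr_ge0// mulr_ge0.
- by rewrite /B ler_wpM2r ?addr_ge0// ler_wpM2l// lerDl.
- by rewrite ge_min lexx orbT.
Qed.

Section LaggedRegression.
Context {R : realType} {n : nat}.

(** The n.+1 regressors indexed by ordinals, the lagged response coming first. *)
Definition design (y : int -> R) (z : 'I_n -> int -> R) (k : 'I_n.+1) (t : int) : R :=
  if unlift ord0 k is Some i then z i (t - 1) else y (t - 1).

Definition coef (p : R) (a : 'cV[R]_n) : 'cV[R]_n.+1 :=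
  \col_k (if unlift ord0 k is Some i then a i 0 else p).

Lemma coefK (b : 'cV[R]_n.+1) : coef (b ord0 0) (\col_i b (lift ord0 i) 0) = b.
Proof.
by apply/matrixP => k j; rewrite (ord1 j) mxE; case: unliftP => [i ->|->]; rewrite ?mxE.
Qed.

Lemma rss_lsq y z N p a :
  rss y z N p a = lsq (fun k t => design y z k t%:Z) (fun t => y t%:Z) N (coef p a).
Proof.
rewrite /rss /lsq; apply: eq_bigr => t _; rewrite big_ord_recl /design /coef.
rewrite mxE unlift_none opprD addrA addrAC; congr ((_ - _ - _) ^+ 2).
by apply: eq_bigr => i _; rewrite mxE liftK.
Qed.

(** With an invertible Gram matrix the minimizer is unique, so the estimate, which
    is only specified in that case, is the solution of the normal equations. *)
Lemma ols_normal_equation y z N p a :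
  let X k (t : nat) := design y z k t%:Z in
  gram X N \in unitmx -> ols_estimate y z N p a ->
  gram X N *m coef p a = cross X (fun t => y t%:Z) N.
Proof.
move=> X uG est; have [b [normal bmin buniq]] := lsq_unique_minimizer (fun t => y t%:Z) uG.
have [Ep Ea] : p = b ord0 0 /\ a = \col_i b (lift ord0 i) 0.
  apply: est; first by move=> p' a'; rewrite !rss_lsq coefK.
  move=> p' a' min'; have := min' (b ord0 0) (\col_i b (lift ord0 i) 0).
  rewrite !rss_lsq coefK => /buniq <-; split; first by rewrite mxE unlift_none.
  by apply/matrixP => i j; rewrite (ord1 j) !mxE liftK.
by rewrite Ep Ea coefK.
Qed.

End LaggedRegression.

Section Consistency.
Context {d : measure_display} {T : measurableType d} {R : realType}.
Variable P : probability T R.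
Context {n : nat}.
Variables (y : int -> T -> R) (z : 'I_n -> int -> T -> R).
Hypothesis my : forall t, measurable_fun [set: T] (y t).
Hypothesis mz : forall i t, measurable_fun [set: T] (z i t).

Definition regressor (k : 'I_n.+1) (t : int) (w : T) : R :=
  design (fun t => y t w) (fun i t => z i t w) k t.

Let mreg k t : measurable_fun [set: T] (regressor k t).
Proof. by rewrite /regressor /design; case: (unlift ord0 k). Qed.

Variables (M : 'M[R]_n.+1) (v theta : 'cV[R]_n.+1).
Hypothesis uM : M \in unitmx.
Hypothesis Mtheta : M *m theta = v.
Hypothesis cvgM : forall k l, cvg_in_prob P
  (fun N w =>
    (\sum_(1 <= t < N.+1) regressor k t%:Z w * regressor l t%:Z w) / N%:R) (M k l).
Hypothesis cvgv : forall k, cvg_in_prob P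
  (fun N w => (\sum_(1 <= t < N.+1) regressor k t%:Z w * y t%:Z w) / N%:R) (v k 0).

(** On the samples whose moments are close to their limits the design is
    invertible, so the estimate, otherwise arbitrary, solves the normal equations. *)
Lemma ols_consistent (phihat : nat -> {RV P >-> R})
    (alphahat : nat -> 'I_n -> {RV P >-> R}) :
  (forall (N : nat) (w : T),
     ols_estimate (fun t => y t w) (fun i t => z i t w) N
       (phihat N w) (\col_i alphahat N i w)) ->
  cvg_in_prob P (fun N => phihat N) (theta ord0 0) /\
  (forall i, cvg_in_prob P (fun N => alphahat N i) (theta (lift ord0 i) 0)).
Proof.
move=> est.
pose bhat N w := coef (phihat N w) (\col_i alphahat N i w).
suff main k : (forall N, measurable_fun [set: T] (fun w => bhat N w k 0)) ->
    cvg_in_prob P (fun N w => bhat N w k 0) (theta k 0).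
  split=> [|i].
    have e N : (phihat N : T -> R) = (fun w => bhat N w ord0 0).
      by apply/funext => w; rewrite mxE unlift_none.
    have -> : (fun N => phihat N : T -> R) = (fun N w => bhat N w ord0 0) by exact/funext.
    by apply: main => N; rewrite -e.
  have e N : (alphahat N i : T -> R) = (fun w => bhat N w (lift ord0 i) 0).
    by apply/funext => w; rewrite mxE liftK mxE.
  have -> : (fun N => alphahat N i : T -> R) =
      (fun N w => bhat N w (lift ord0 i) 0) by exact/funext.
  by apply: main => N; rewrite -e.
move=> mb.
pose I := ('I_n.+1 * 'I_n.+1 + 'I_n.+1)%type.
pose X (i : I) (N : nat) (w : T) : R := match i with
  | inl p => (\sum_(1 <= t < N.+1) regressor p.1 t%:Z w * regressor p.2 t%:Z w) / N%:R
  | inr k => (\sum_(1 <= t < N.+1) regressor k t%:Z w * y t%:Z w) / N%:R end.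
pose l (i : I) : R := match i with inl p => M p.1 p.2 | inr k => v k 0 end.
apply: (@cvg_in_prob_continuous _ _ _ P I X l) => //.
- by move=> [p|j] N; apply: measurable_funM => //; apply: measurable_sum => t;
    apply: measurable_funM.
- move=> e e0; have [del del0 H] := linear_system_continuous uM Mtheta e0.
  exists del => // N w N0 Hw.
  have NR0 : N%:R != 0 :> R by rewrite pnatr_eq0 -lt0n.
  set Xw := fun k (t : nat) => regressor k t%:Z w.
  have [] := H (N%:R^-1 *: gram Xw N) (N%:R^-1 *: cross Xw (fun t => y t%:Z w) N).
  + by move=> a b; have := Hw (inl (a, b)); rewrite /X /l/= !mxE mulrC.
  + by move=> a; have := Hw (inr a); rewrite /X /l/= !mxE mulrC.
  move=> uS sol; apply: sol; rewrite -scalemxAl; congr (_ *: _).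
  apply: (ols_normal_equation _ (est N w)).
  have -> : gram Xw N = N%:R *: (N%:R^-1 *: gram Xw N) by rewrite scalerA divff// scale1r.
  by rewrite unitmxZ// unitfE.
- by move=> [p|j]; [exact: cvgM|exact: cvgv].
Qed.

End Consistency.

(** * Gaussian spans and autoregressions *)

Section GaussianSpan.
Context {d : measure_display} {T : measurableType d} {R : realType}.
Variable P : probability T R.
Local Notation mean := (mean P).
Local Notation ip := (ip P).
Local Notation L4 := (L4 P).
Context {J : Type}.
Variable Z : int -> J -> T -> R.
Hypothesis mZ : forall t j, measurable_fun [set: T] (Z t j).
Hypothesis gaussZ : gaussian_process P Z.

Definition lincomb (s : seq (R * (int * J))) (w : T) : R :=
  \sum_(p <- s) p.1 * Z p.2.1 p.2.2 w.

Definition gaussian_span (X : T -> R) : Prop :=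
  measurable_fun [set: T] X /\ exists s, {ae P, forall w, lincomb s w = X w}.

Lemma measurable_lincomb s : measurable_fun [set: T] (lincomb s).
Proof. by apply: measurable_sum => p; exact: measurable_funM. Qed.

Lemma gaussian_lincomb s : gaussian P (lincomb s).
Proof.
have -> : lincomb s = (fun w => \sum_(i < size s) (tnth (in_tuple s) i).1 *
    Z (tnth (in_tuple s) i).2.1 (tnth (in_tuple s) i).2.2 w).
  by apply/funext => w; rewrite /lincomb big_tnth.
exact: gaussZ.
Qed.

Lemma gaussian_span_L4 X : gaussian_span X -> L4 X.
Proof.
move=> [mX [s sX]].
have [LX _] := gaussian_moments (measurable_lincomb s) (gaussian_lincomb s).
exact: (L4_ae LX mX sX).
Qed.

Lemma gaussian_span_gen t j : gaussian_span (Z t j).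
Proof.
split => //; exists [:: (1, (t, j))].
by apply: aeW => w; rewrite /lincomb big_seq1 mul1r.
Qed.

Lemma gaussian_spanD X Y : gaussian_span X -> gaussian_span Y -> gaussian_span (X \+ Y).
Proof.
move=> [mX [s sX]] [mY [r rY]]; split; first exact: measurable_funD.
exists (s ++ r); apply: filterS2 sX rY => w /= <- <-.
by rewrite /lincomb big_cat.
Qed.

Lemma gaussian_spanZ a X : gaussian_span X -> gaussian_span (a \*o X).
Proof.
move=> [mX [s sX]]; split; first exact: measurable_funM.
exists [seq (a * p.1, p.2) | p <- s]; apply: filterS sX => w /= <-.
by rewrite /lincomb big_map mulr_sumr; apply: eq_bigr => p _; rewrite mulrA.
Qed.

Lemma gaussian_span_ae X Y : gaussian_span X -> measurable_fun [set: T] Y ->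
  {ae P, forall w, X w = Y w} -> gaussian_span Y.
Proof.
move=> [mX [s sX]] mY XY; split => //; exists s.
by apply: filterS2 sX XY => w <- <-.
Qed.

Lemma gaussian_span_sum (I : Type) (s : seq I) (a : I -> R) (X : I -> T -> R) :
  (forall i, gaussian_span (X i)) -> gaussian_span (fun w => \sum_(i <- s) a i * X i w).
Proof.
move=> VX; elim: s => [|i s IH].
  split; first by apply: measurable_sum => i; apply: measurable_funM => //; case: (VX i).
  by exists [::]; apply: aeW => w; rewrite /lincomb !big_nil.
have -> : (fun w => \sum_(j <- i :: s) a j * X j w) =
    (a i \*o X i) \+ (fun w => \sum_(j <- s) a j * X j w).
  by apply/funext => w; rewrite big_cons.
by apply: gaussian_spanD => //; exact: gaussian_spanZ.
Qed.

(** Almost sure equality is the reason for working with L4 and the kurtosis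
    relation: both pass from a linear combination to its modifications. *)
Lemma gaussian_span_centered : (forall t j, mean (Z t j) = 0) ->
  centered_gaussian_space P gaussian_span.
Proof.
move=> Z0.
have LZ t j : L4 (Z t j) := gaussian_span_L4 (gaussian_span_gen t j).
have mean0 s : mean (lincomb s) = 0.
  rewrite /lincomb (@mean_sum _ _ _ P _ s (fun p w => p.1 * Z p.2.1 p.2.2 w)).
    by rewrite big1// => p _; have := meanZ p.1 (LZ p.2.1 p.2.2); rewrite Z0 mulr0.
  by move=> p; have := integrable_L4 (L4Z p.1 (LZ p.2.1 p.2.2)).
split.
- exact: gaussian_span_L4.
- move=> X VX; have LX := gaussian_span_L4 VX; have [mX [s sX]] := VX.
  have ms := measurable_lincomb s.
  have [Ls H] := gaussian_moments ms (gaussian_lincomb s).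
  rewrite -(ip_ael Ls LX LX sX) ipC -(ip_ael Ls LX Ls sX) -(H (mean0 s)).
  apply: mean_ae; [exact: measurable_funX|exact: measurable_funX|].
  by apply: filterS sX => w ->.
- exact: gaussian_spanD.
- exact: gaussian_spanZ.
- exact: gaussian_span_ae.
Qed.

End GaussianSpan.

Section SecondMoments.
Context {d : measure_display} {T : measurableType d} {R : realType}.
Variable P : probability T R.
Local Notation mean := (mean P).
Local Notation ip := (ip P).
Local Notation L4 := (L4 P).

(** Stationarity for families of one variable. *)
Lemma stationary_mean (J : Type) (Z : int -> J -> T -> R) t j h :
  (forall t j, L4 (Z t j)) -> strictly_stationary P Z ->
  mean (Z (t + h) j) = mean (Z t j).
Proof.
move=> LZ statZ; apply: mean_eq_law => //; first by case: (LZ (t + h) j).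
move=> B mB.
pose A : set (1.-tuple R) := (fun v : 1.-tuple R => tnth v ord0) @^-1` B.
have mA : measurable A.
  by have := @measurable_tnth _ R 1 ord0 measurableT B mB; rewrite setTI.
have := statZ 1%N (fun=> t) (fun=> j) h A mA.
by rewrite /A /preimage /=; under eq_set do rewrite tnth_mktuple;
  under [in RHS]eq_set do rewrite tnth_mktuple.
Qed.

Lemma mean_ip X : mean X = ip X (cst 1).
Proof. by apply: eq_Rintegral => w _ /=; rewrite mulr1. Qed.

Lemma L4_sum (I : Type) (s : seq I) (a : I -> R) (X : I -> T -> R) :
  (forall i, L4 (X i)) -> L4 (fun w => \sum_(i <- s) a i * X i w).
Proof.
move=> LX; elim: s => [|i s IH].
  have -> : (fun w => \sum_(i <- [::]) a i * X i w) = cst 0.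
    by apply/funext => w; rewrite big_nil.
  exact: L4_cst.
have -> : (fun w => \sum_(j <- i :: s) a j * X j w) =
    (a i \*o X i) \+ (fun w => \sum_(j <- s) a j * X j w).
  by apply/funext => w; rewrite big_cons.
by apply: L4D => //; exact: L4Z.
Qed.

Lemma ip_suml (I : Type) (s : seq I) (a : I -> R) (X : I -> T -> R) Y :
  (forall i, L4 (X i)) -> L4 Y ->
  ip (fun w => \sum_(i <- s) a i * X i w) Y = \sum_(i <- s) a i * ip (X i) Y.
Proof.
move=> LX LY; elim: s => [|i s IH].
  rewrite big_nil -[RHS](mean_cst P 0); apply: eq_Rintegral => w _.
  by rewrite /= big_nil mul0r.
rewrite big_cons -IH -ipZl// -ipDl//; [|exact: L4Z|exact: L4_sum].
by congr ip; apply/funext => w; rewrite /= big_cons.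
Qed.

Section Autoregression.
Variables (A v : int -> T -> R) (rho : R).
Hypothesis LA : forall t, L4 (A t).
Hypothesis Lv : forall t, L4 (v t).
Hypothesis rec : forall t, {ae P, forall w, A t w = rho * A (t - 1) w + v t w}.

Lemma ar_step t X : L4 X -> ip (A t) X = rho * ip (A (t - 1)) X + ip (v t) X.
Proof.
move=> LX; have LrA := L4Z rho (LA (t - 1)).
rewrite -ipZl// -ipDl//; apply: ip_ael => //; exact: L4D.
Qed.

Lemma ar_forward t X (k : nat) : L4 X ->
  (forall l : nat, ip (v (t + l.+1%:Z)) X = 0) ->
  ip (A (t + k%:Z)) X = rho ^+ k * ip (A t) X.
Proof.
move=> LX v0; elim: k => [|k IH]; first by rewrite addr0 mul1r.
rewrite ar_step// v0 addr0 exprS -mulrA -IH; congr (_ * ip (A _) _); lia.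
Qed.

Hypothesis rho1 : `|rho| < 1.

(** Iterating the recursion backwards, the influence of the distant past is
    damped by a power of rho, so only the innovations matter. *)
Lemma ar_orthogonal t X K : L4 X -> (forall s, `|ip (A s) X| <= K) ->
  (forall l : nat, ip (v (t - l%:Z)) X = 0) -> ip (A t) X = 0.
Proof.
move=> LX bnd v0.
have back (k : nat) : ip (A t) X = rho ^+ k * ip (A (t - k%:Z)) X.
  elim: k => [|k IH]; first by rewrite subr0 mul1r.
  rewrite IH ar_step// v0 addr0 exprSr -mulrA; congr (_ * (_ * ip (A _) _)); lia.
have le (k : nat) : `|ip (A t) X| <= `|rho| ^+ k * K.
  by rewrite (back k) normrM normrX ler_wpM2l ?exprn_ge0.
apply/eqP; rewrite -normr_le0.
have cv : (fun k : nat => `|rho| ^+ k * K) @ \oo --> (0 : R).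
  rewrite -[X in _ --> X](mul0r K); apply: cvgM; last exact: cvg_cst.
  by apply: cvg_expr; rewrite normr_id.
rewrite -(cvg_lim _ cv)//; apply: limr_ge; first exact: (cvgP _ cv).
exact: nearW.
Qed.

End Autoregression.

Lemma vanishing_geometric (rho c : R) : `|rho| < 1 ->
  vanishing (fun z => rho ^+ `|z|%N * c).
Proof.
move=> rho1 e e0.
have : (fun k : nat => `|rho| ^+ k * `|c|) @ \oo --> (0 : R).
  rewrite -[X in _ --> X](mul0r `|c|); apply: cvgM; last exact: cvg_cst.
  by apply: cvg_expr; rewrite normr_id.
move=> /cvgrPdist_le /(_ e e0) [M _ HM]; exists M => z /HM /=.
by rewrite sub0r normrN normrM normr_id normrX !normr_id -normrX -normrM.
Qed.

End SecondMoments.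

(** * Second moments of the model *)

Section Model.
Context {d : measure_display} {T : measurableType d} {R : realType}.
Variable P : probability T R.
Local Notation ip := (ip P).
Local Notation L4 := (L4 P).
Context {n : nat}.
Variables (alphas : 'cV[R]_n) (phi phie : R).
Hypothesis phi1 : `|phi| < 1.
Hypothesis phie1 : `|phie| < 1.
Variables (y eps omega : int -> T -> R) (x u : 'I_n -> int -> T -> R).
Variable V : (T -> R) -> Prop.
Hypothesis gV : centered_gaussian_space P V.
Hypothesis Vy : forall t, V (y t).
Hypothesis Vx : forall i t, V (x i t).
Hypothesis Veps : forall t, V (eps t).
Hypothesis Vu : forall i t, V (u i t).
Hypothesis Vomega : forall t, V (omega t).

(** The part of the response predicted by the regressors, dated by them: it is
    signal (t - 1) that enters y t. *)
Definition signal (t : int) (w : T) : R := \sum_(i < n) alphas i 0 * x i t w.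

Hypothesis hy : forall t, {ae P, forall w, y t w = signal (t - 1) w + eps t w}.
Hypothesis hx : forall i t, {ae P, forall w, x i t w = phi * x i (t - 1) w + u i t w}.
Hypothesis heps : forall t, {ae P, forall w, eps t w = phie * eps (t - 1) w + omega t w}.
Hypothesis uu : forall i j s t, s != t -> ip (u i s) (u j t) = 0.
Hypothesis uo : forall i s t, ip (u i s) (omega t) = 0.
Hypothesis oo : forall s t, s != t -> ip (omega s) (omega t) = 0.
Variables (Cx : 'M[R]_n) (sy2 : R).
Hypothesis hCx : forall t i j, ip (x i t) (x j t) = Cx i j.
Hypothesis hsy2 : forall t, ip (y t) (y t) = sy2.

Let VL4 X : V X -> L4 X. Proof. by case: gV => H _ _ _ _; exact: H. Qed.
Let Ly t : L4 (y t) := VL4 (Vy t).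
Let Lx i t : L4 (x i t) := VL4 (Vx i t).
Let Le t : L4 (eps t) := VL4 (Veps t).
Let Lu i t : L4 (u i t) := VL4 (Vu i t).
Let Lo t : L4 (omega t) := VL4 (Vomega t).
Let Lsig t : L4 (signal t). Proof. exact: L4_sum. Qed.

Let Cx_sym i j : Cx i j = Cx j i.
Proof. by rewrite -(hCx 0 i j) ipC hCx. Qed.

(* the entries of C alpha, and alpha' C alpha *)
Let c (i : 'I_n) : R := \sum_(j < n) alphas j 0 * Cx j i.
Let q : R := \sum_(i < n) alphas i 0 * c i.

Lemma ip_signal_x t i : ip (signal t) (x i t) = c i.
Proof. by rewrite ip_suml//; apply: eq_bigr => j _; rewrite hCx. Qed.

Lemma ip_signal t : ip (signal t) (signal t) = q.
Proof.
by rewrite ip_suml//; apply: eq_bigr => i _; rewrite ipC ip_signal_x.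
Qed.

Lemma ip_x_future_u i j (s t : int) : s < t -> ip (x i s) (u j t) = 0.
Proof.
move=> st; apply: (ar_orthogonal (Lx i) (Lu i) (hx i) phi1 (Lu j t)
    (K := Cx i i + ip (u j t) (u j t))).
- by move=> r; apply: le_trans (ip_norm_le (Lx i r) (Lu j t)) _; rewrite hCx.
- by move=> l; apply: uu; lia.
Qed.

Lemma ip_x_omega i s t : ip (x i s) (omega t) = 0.
Proof.
apply: (ar_orthogonal (Lx i) (Lu i) (hx i) phi1 (Lo t)
    (K := Cx i i + ip (omega t) (omega t))) => //.
by move=> r; apply: le_trans (ip_norm_le (Lx i r) (Lo t)) _; rewrite hCx.
Qed.

(** A bound uniform in t is what ar_orthogonal requires of eps; the exact second
    moment of eps is derived later, by means of this bound. *)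
Lemma ip_eps_bounded t : ip (eps t) (eps t) <= 3 * (sy2 + q).
Proof.
have LZ := L4Z (-1) (Lsig (t - 1)).
have e1 : ip (eps t) (eps t) = sy2 - 2 * ip (y t) (signal (t - 1)) + q.
  have ae1 : {ae P, forall w, (1 \*o y t \+ (-1) \*o signal (t - 1)) w = eps t w}.
    by apply: filterS (hy t) => w /= ->; ring.
  have LS : L4 (1 \*o y t \+ (-1) \*o signal (t - 1)) by apply: L4D => //; exact: L4Z.
  rewrite -(ip_ael LS (Le t) (Le t) ae1) ipC -(ip_ael LS (Le t) LS ae1).
  by rewrite ip_lincomb2// hsy2 ip_signal (ipC P (signal _)); ring.
have := ip_norm_le (Ly t) (Lsig (t - 1)); rewrite hsy2 ip_signal ler_norml => /andP[h _].
by rewrite e1; lra.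
Qed.

Lemma ip_eps_x i s t : ip (eps s) (x i t) = 0.
Proof.
apply: (ar_orthogonal Le Lo heps phie1 (Lx i t) (K := 3 * (sy2 + q) + Cx i i)).
- move=> r; apply: le_trans (ip_norm_le (Le r) (Lx i t)) _.
  by rewrite hCx lerD2r ip_eps_bounded.
- by move=> l; rewrite ipC ip_x_omega.
Qed.

Lemma ip_eps_future_omega (s t : int) : s < t -> ip (eps s) (omega t) = 0.
Proof.
move=> st; apply: (ar_orthogonal Le Lo heps phie1 (Lo t)
   (K := 3 * (sy2 + q) + ip (omega t) (omega t))).
- move=> r; apply: le_trans (ip_norm_le (Le r) (Lo t)) _.
  by rewrite lerD2r ip_eps_bounded.
- by move=> l; apply: oo; lia.
Qed.

Lemma ip_signal_eps s t : ip (signal s) (eps t) = 0.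
Proof. by rewrite ip_suml// big1// => i _; rewrite ipC ip_eps_x mulr0. Qed.

Lemma ip_yl t X : L4 X -> ip (y t) X = ip (signal (t - 1)) X + ip (eps t) X.
Proof.
move=> LX; rewrite -ipDl//; apply: ip_ael => //; exact: L4D.
Qed.

Lemma ip_eps t : ip (eps t) (eps t) = sy2 - q.
Proof.
rewrite -(hsy2 t) ip_yl// [in X in X + _]ipC [in X in _ + X - _]ipC !ip_yl//.
by rewrite ip_signal ip_signal_eps (ipC P (eps t)) ip_signal_eps; ring.
Qed.

(** The innovations after t are uncorrelated with the past, so that beyond t the
    recursion multiplies the covariances by phi at each step. *)
Lemma ip_x_lag i j t (k : nat) : ip (x i (t + k%:Z)) (x j t) = phi ^+ k * Cx i j.
Proof.
rewrite (ar_forward (Lx i) (Lu i) (hx i)) ?hCx// => l.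
by rewrite ipC ip_x_future_u//; lia.
Qed.

Lemma ip_eps_lag t (k : nat) : ip (eps (t + k%:Z)) (eps t) = phie ^+ k * (sy2 - q).
Proof.
rewrite (ar_forward Le Lo heps) ?ip_eps// => l.
by rewrite ipC ip_eps_future_omega//; lia.
Qed.

Let W (j : option 'I_n) : int -> T -> R := if j is Some i then x i else eps.

Let VW j t : V (W j t). Proof. by case: j => [i|]; [exact: Vx|exact: Veps]. Qed.

Let decW j k : decorrelating P (W j) (W k).
Proof.
case: j k => [i|] [j|] /=.
- exists (fun z => phi ^+ `|z|%N * Cx i j); last exact: vanishing_geometric.
  move=> s t; have -> : s = t + (s - t) by ring.
  rewrite [t + _ - t]addrAC subrr add0r; case: (intP (s - t)) => [|k|k].
  + by rewrite addr0 hCx mul1r.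
  + exact: ip_x_lag.
  + have {2}-> : t = t - k.+1%:Z + k.+1%:Z by ring.
    by rewrite ipC ip_x_lag Cx_sym abszN.
- exists (fun=> 0) => [s t|e e0]; first by rewrite ipC ip_eps_x.
  by exists 0%N => z _; rewrite normr0 ltW.
- exists (fun=> 0) => [s t|e e0]; first by rewrite ip_eps_x.
  by exists 0%N => z _; rewrite normr0 ltW.
- exists (fun z => phie ^+ `|z|%N * (sy2 - q)); last exact: vanishing_geometric.
  move=> s t; have -> : s = t + (s - t) by ring.
  rewrite [t + _ - t]addrAC subrr add0r; case: (intP (s - t)) => [|k|k].
  + by rewrite addr0 ip_eps mul1r.
  + exact: ip_eps_lag.
  + have {2}-> : t = t - k.+1%:Z + k.+1%:Z by ring.
    by rewrite ipC ip_eps_lag abszN.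
Qed.

Let fx i : filtered P W (x i). Proof. exact: (filtered_base P W (Some i)). Qed.
Let feps : filtered P W eps. Proof. exact: (filtered_base P W None). Qed.

Let fsignal : filtered P W signal.
Proof.
rewrite /signal; elim: (index_enum _) => [|i s IH].
  have -> : (fun t w => \sum_(i <- [::]) alphas i 0 * x i t w) = (fun t => 0 \*o eps t).
    by apply/funext => t; apply/funext => w; rewrite big_nil /= mul0r.
  exact: filtered_scale.
have -> : (fun t w => \sum_(j <- i :: s) alphas j 0 * x j t w) =
   (fun t => (alphas i 0 \*o x i t) \+ (fun w => \sum_(j <- s) alphas j 0 * x j t w)).
  by apply/funext => t; apply/funext => w; rewrite big_cons.
by apply: filtered_add => //; exact: filtered_scale.
Qed.

Let fy : filtered P W y.
Proof.
apply: (filtered_ae (A := fun t => signal (t - 1) \+ eps t)).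
- by apply: filtered_add => //; exact: (filtered_shift (-1) fsignal).
- by move=> t; case: (Ly t).
- by move=> t; apply: filterS (hy t) => w /= ->.
Qed.

Let fu i : filtered P W (u i).
Proof.
apply: (filtered_ae (A := fun t => x i t \+ (- phi) \*o x i (t - 1))).
- apply: filtered_add => //; apply: filtered_scale.
  exact: (filtered_shift (-1) (fx i)).
- by move=> t; case: (Lu i t).
- by move=> t; apply: filterS (hx i t) => w /= ->; ring.
Qed.

Lemma sample_covariance_x i j :
  cvg_in_prob P (fun N w => (\sum_(1 <= t < N.+1) x i t%:Z w * x j t%:Z w) / N%:R) (Cx i j).
Proof. by rewrite -(hCx 0); exact: (cvg_in_prob_filtered gV VW decW). Qed.

(** The limits of the sample moments are the population moments at any fixed date,
    so theta only has to solve the population normal equations. *)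
Lemma ols_consistent_filtered (z : 'I_n -> int -> T -> R) (theta : 'cV[R]_n.+1)
    (M : 'M[R]_n.+1) :
  (forall i, filtered P W (z i)) -> M \in unitmx ->
  (forall k l, ip (regressor y z k 0) (regressor y z l 0) = M k l) ->
  (forall k, ip (regressor y z k 0) (y 0) = (M *m theta) k 0) ->
  forall (phihat : nat -> {RV P >-> R}) (alphahat : nat -> 'I_n -> {RV P >-> R}),
  (forall (N : nat) (w : T),
     ols_estimate (fun t => y t w) (fun i t => z i t w) N
       (phihat N w) (\col_i alphahat N i w)) ->
  cvg_in_prob P (fun N => phihat N) (theta ord0 0) /\
  (forall i, cvg_in_prob P (fun N => alphahat N i) (theta (lift ord0 i) 0)).
Proof.
move=> fz uM eM ev.
have freg k : filtered P W (regressor y z k).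
  rewrite /regressor /design; case: (unlift ord0 k) => [i|].
    exact: (filtered_shift (-1) (fz i)).
  exact: (filtered_shift (-1) fy).
have mz i t : measurable_fun [set: T] (z i t).
  by case: (VL4 (filtered_space gV VW (fz i) t)).
have my t : measurable_fun [set: T] (y t) by case: (Ly t).
apply: (ols_consistent my mz uM erefl).
- by move=> k l; rewrite -eM; exact: (cvg_in_prob_filtered gV VW decW).
- by move=> k; rewrite -ev; exact: (cvg_in_prob_filtered gV VW decW).
Qed.

Lemma ip_y_x_lag i t : ip (y t) (x i (t - 1)) = c i.
Proof. by rewrite ip_yl// ip_signal_x ip_eps_x addr0. Qed.

Lemma ip_y_x i t : ip (y t) (x i t) = phi * c i.
Proof.
rewrite ip_yl// ip_eps_x addr0 ip_suml// mulr_sumr; apply: eq_bigr => j _.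
have := ip_x_lag i j (t - 1) 1; rewrite subrK ipC => ->.
by rewrite Cx_sym; ring.
Qed.

Lemma ip_y_lag t : ip (y (t - 1)) (y t) = phi * q + phie * (sy2 - q).
Proof.
rewrite ipC ip_yl// ip_suml//; congr (_ + _).
  rewrite mulr_sumr; apply: eq_bigr => i _.
  by rewrite ipC ip_y_x; ring.
rewrite ipC ip_yl// ip_signal_eps add0r ipC.
by have := ip_eps_lag (t - 1) 1; rewrite subrK expr1.
Qed.

Lemma ip_ul i t X : L4 X -> ip (u i t) X = ip (x i t) X - phi * ip (x i (t - 1)) X.
Proof.
by move=> LX; rewrite (ar_step (Lx i) (Lu i) (hx i))//; ring.
Qed.

Lemma ip_u_y i t : ip (u i t) (y t) = 0.
Proof. by rewrite ip_ul// ipC ip_y_x ipC ip_y_x_lag subrr. Qed.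

Lemma ip_u_x i j t : ip (u i t) (x j t) = (1 - phi ^+ 2) * Cx i j.
Proof.
rewrite ip_ul// hCx ipC.
have := ip_x_lag j i (t - 1) 1; rewrite subrK => ->.
by rewrite Cx_sym; ring.
Qed.

Lemma ip_u_y_lead i t : ip (u i (t - 1)) (y t) = (1 - phi ^+ 2) * c i.
Proof.
rewrite ipC ip_yl// ip_suml//.
have -> : ip (eps t) (u i (t - 1)) = 0.
  by rewrite ipC ip_ul// ipC ip_eps_x ipC ip_eps_x; ring.
rewrite addr0 mulr_sumr; apply: eq_bigr => j _.
by rewrite ipC ip_u_x Cx_sym; ring.
Qed.

Lemma ip_u i j t : ip (u i t) (u j t) = (1 - phi ^+ 2) * Cx i j.
Proof.
rewrite ipC ip_ul// ipC ip_u_x ip_x_future_u; last by lia.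
by rewrite mulr0 subr0.
Qed.

Lemma regressor0 z t : regressor y z (@ord0 n) t = y (t - 1).
Proof. by apply/funext => w; rewrite /regressor /design unlift_none. Qed.

Lemma regressorS (z : 'I_n -> int -> T -> R) i t :
  regressor y z (lift ord0 i) t = z i (t - 1).
Proof. by apply/funext => w; rewrite /regressor /design liftK. Qed.

Hypothesis pdC : positive_definite Cx.
Hypothesis sy2_gt0 : 0 < sy2.

Let cE i : \sum_(j < n) Cx i j * alphas j 0 = c i.
Proof. by apply: eq_bigr => j _; rewrite Cx_sym mulrC. Qed.

Let qE : (alphas^T *m Cx *m alphas) 0 0 = q.
Proof.
rewrite mxE; apply: eq_bigr => i _; rewrite mxE mulrC; congr (_ * _).
by apply: eq_bigr => j _; rewrite mxE.
Qed.

Let q_le : q <= sy2.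
Proof. by rewrite -subr_ge0 -(ip_eps 0) ip_ge0. Qed.

Let phi2_lt1 : phi ^+ 2 < 1.
Proof. by rewrite -real_normK ?num_real// expr_lt1. Qed.

Let q_ge0 : 0 <= q. Proof. by rewrite -(ip_signal 0) ip_ge0. Qed.

(* the pivot left after eliminating the regressors x in the first regression;
   phi ^ 2 q < q fails for q = 0, where the pivot is sy2 itself *)
Let resid_gt0 : 0 < sy2 - phi ^+ 2 * q.
Proof.
rewrite subr_gt0; have [->|q0] := eqVneq q 0; first by rewrite mulr0.
apply: lt_le_trans q_le; rewrite gtr_pMl// lt_neqAle eq_sym q0.
exact: q_ge0.
Qed.

Lemma Cx_injective (a : 'I_n -> R) :
  (forall i, \sum_(j < n) Cx i j * a j = 0) -> forall i, a i = 0.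
Proof.
move=> Ca; have [_ pos] := pdC.
suff : \col_i a i = 0 :> 'cV[R]_n.
  by move=> a0 i; have := congr1 (fun v : 'cV_n => v i 0) a0; rewrite !mxE.
apply/eqP; apply: contraT => /pos.
rewrite -mulmxA (_ : Cx *m \col_i a i = 0) ?mulmx0 ?mxE ?ltxx//.
apply/matrixP => i j; rewrite !mxE -[RHS](Ca i); apply: eq_bigr => k _.
by rewrite mxE.
Qed.

Let R2 : R := (alphas^T *m Cx *m alphas) 0 0 / sy2.

Lemma ols_lagged_x (phihat : nat -> {RV P >-> R})
    (alphahat : nat -> 'I_n -> {RV P >-> R}) :
  (forall (N : nat) (w : T),
     ols_estimate (fun t => y t w) (fun i t => x i t w) N
       (phihat N w) (\col_i alphahat N i w)) ->
  cvg_in_prob P (fun N => phihat N) (phie * (1 - R2) / (1 - phi ^+ 2 * R2)) /\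
  (forall i : 'I_n, cvg_in_prob P (fun N => alphahat N i)
    (alphas i 0 * (1 - phi * phie * (1 - R2) / (1 - phi ^+ 2 * R2)))).
Proof.
pose p := phie * (1 - R2) / (1 - phi ^+ 2 * R2).
pose a := \col_i (alphas i 0 * (1 - phi * phie * (1 - R2) / (1 - phi ^+ 2 * R2))).
pose theta := coef p a.
have th0 : theta ord0 0 = p by rewrite mxE unlift_none.
have thS i : theta (lift ord0 i) 0 = alphas i 0 * (1 - phi * p).
  by rewrite !mxE liftK mxE /p; congr (_ * (1 - _)); ring.
pose M : 'M[R]_n.+1 := \matrix_(k, l) ip (regressor y x k 0) (regressor y x l 0).
have M0 (h : 'cV[R]_n.+1) : (M *m h) ord0 0 =
    sy2 * h ord0 0 + phi * \sum_i c i * h (lift ord0 i) 0.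
  rewrite mxE big_ord_recl mxE !regressor0 hsy2 mulr_sumr; congr (_ + _).
  by apply: eq_bigr => i _; rewrite mxE regressor0 regressorS ip_y_x mulrA.
have MS (h : 'cV[R]_n.+1) i : (M *m h) (lift ord0 i) 0 =
    phi * c i * h ord0 0 + \sum_j Cx i j * h (lift ord0 j) 0.
  rewrite mxE big_ord_recl mxE regressor0 regressorS ipC ip_y_x; congr (_ + _).
  by apply: eq_bigr => j _; rewrite mxE !regressorS hCx.
have := @ols_consistent_filtered x theta M fx.
rewrite th0 /p => H est.
have [] := H _ _ _ phihat alphahat est.
- apply: unitmx_injective => h Mh.
  have hS i : h (lift ord0 i) 0 + phi * h ord0 0 * alphas i 0 = 0.
    apply: (Cx_injective (a := fun i => h (lift ord0 i) 0 + phi * h ord0 0 * alphas i 0)).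
    move=> k; under eq_bigr do rewrite mulrDr (mulrCA (Cx k _)).
    rewrite big_split /= -mulr_sumr cE.
    have e : (M *m h) (lift ord0 k) 0 = 0 by rewrite Mh mxE.
    by apply: eq_trans e; rewrite MS; ring.
  have {}hS i : h (lift ord0 i) 0 = - phi * h ord0 0 * alphas i 0.
    by apply/eqP; rewrite -subr_eq0 -[X in _ == X](hS i); apply/eqP; ring.
  have h0 : h ord0 0 = 0.
    have e : (sy2 - phi ^+ 2 * q) * h ord0 0 = 0.
      have e : (M *m h) ord0 0 = 0 by rewrite Mh mxE.
      apply: eq_trans e; rewrite M0.
      have -> : \sum_i c i * h (lift ord0 i) 0 = - phi * h ord0 0 * q.
        by rewrite mulr_sumr; apply: eq_bigr => i _; rewrite hS; ring.
      by ring.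
    by move/eqP: e; rewrite mulf_eq0 gt_eqF//= => /eqP.
  apply/matrixP => k j; rewrite (ord1 j) mxE.
  by case: (unliftP ord0 k) => [i ->|->] //; rewrite hS h0 mulr0 mul0r.
- by move=> k l; rewrite mxE.
- have den : sy2 - phi ^+ 2 * q != 0 by rewrite gt_eqF.
  have pE : p * (sy2 - phi ^+ 2 * q) = phie * (sy2 - q).
    by rewrite /p /R2 qE; field; rewrite den gt_eqF.
  move=> k; case: (unliftP ord0 k) => [i ->|->].
    rewrite MS th0 regressorS ipC ip_y_x_lag.
    have -> : \sum_j Cx i j * theta (lift ord0 j) 0 = (1 - phi * p) * c i.
      by rewrite -cE mulr_sumr; apply: eq_bigr => j _; rewrite thS; ring.
    by ring.
  rewrite M0 th0 regressor0 ip_y_lag.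
  have -> : \sum_i c i * theta (lift ord0 i) 0 = (1 - phi * p) * q.
    by rewrite mulr_sumr; apply: eq_bigr => i _; rewrite thS; ring.
  by rewrite -pE; ring.
move=> H1 H2; split => // i; have := H2 i.
by rewrite thS /p mulrA mulrA.
Qed.

Lemma ols_lagged_u (phihat : nat -> {RV P >-> R})
    (alphahat : nat -> 'I_n -> {RV P >-> R}) :
  (forall (N : nat) (w : T),
     ols_estimate (fun t => y t w) (fun i t => u i t w) N
       (phihat N w) (\col_i alphahat N i w)) ->
  cvg_in_prob P (fun N => phihat N) (phi * R2 + phie * (1 - R2)) /\
  (forall i : 'I_n, cvg_in_prob P (fun N => alphahat N i) (alphas i 0)).
Proof.
pose p := phi * R2 + phie * (1 - R2).
pose theta := coef p alphas.
have th0 : theta ord0 0 = p by rewrite mxE unlift_none.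
have thS i : theta (lift ord0 i) 0 = alphas i 0 by rewrite !mxE liftK.
pose M : 'M[R]_n.+1 := \matrix_(k, l) ip (regressor y u k 0) (regressor y u l 0).
have M0 (h : 'cV[R]_n.+1) : (M *m h) ord0 0 = sy2 * h ord0 0.
  rewrite mxE big_ord_recl mxE !regressor0 hsy2 big1 ?addr0// => i _.
  by rewrite mxE regressor0 regressorS ipC ip_u_y mul0r.
have MS (h : 'cV[R]_n.+1) i : (M *m h) (lift ord0 i) 0 =
    (1 - phi ^+ 2) * \sum_j Cx i j * h (lift ord0 j) 0.
  rewrite mxE big_ord_recl mxE regressor0 regressorS ip_u_y mul0r add0r mulr_sumr.
  by apply: eq_bigr => j _; rewrite mxE !regressorS ip_u mulrA.
have := @ols_consistent_filtered u theta M fu.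
rewrite th0 => H est.
have [] := H _ _ _ phihat alphahat est.
- apply: unitmx_injective => h Mh.
  apply/matrixP => k j; rewrite (ord1 j) mxE.
  case: (unliftP ord0 k) => [i ->|->].
    apply: (Cx_injective (a := fun i => h (lift ord0 i) 0)) => {}i.
    have /eqP := MS h i; rewrite Mh mxE eq_sym mulf_eq0 subr_eq0.
    by rewrite [1 == _]eq_sym lt_eqF//= => /eqP.
  by have /eqP := M0 h; rewrite Mh mxE eq_sym mulf_eq0 gt_eqF//= => /eqP.
- by move=> k l; rewrite mxE.
- move=> k; case: (unliftP ord0 k) => [i ->|->].
    rewrite MS regressorS ip_u_y_lead -cE; congr (_ * _).
    by apply: eq_bigr => j _; rewrite thS.
  by rewrite M0 th0 regressor0 ip_y_lag /p /R2 qE; field; rewrite gt_eqF.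
by move=> H1 H2; split => // i; have := H2 i; rewrite thS.
Qed.

End Model.

(** * The limits of the least squares estimates *)

Theorem proposition4 (d : measure_display) (T : measurableType d) (R : realType)
  (P : probability T R) (n : nat)
  (alphas : 'cV[R]_n) (phi phie : R) (hphi : `|phi| < 1) (hphie : `|phie| < 1)
  (y : int -> {RV P >-> R}) (x : 'I_n -> int -> {RV P >-> R})
  (eps : int -> {RV P >-> R})
  (u : 'I_n -> int -> {RV P >-> R}) (omega : int -> {RV P >-> R})
  (* data generating process *)
  (hy : forall t : int, {ae P, forall w,
     y t w = \sum_(i < n) alphas i 0 * x i (t - 1) w + eps t w})
  (hx : forall (i : 'I_n) (t : int), {ae P, forall w,
     x i t w = phi * x i (t - 1) w + u i t w})
  (heps : forall t : int, {ae P, forall w,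
     eps t w = phie * eps (t - 1) w + omega t w})
  (* standing assumptions *)
  (hgauss : gaussian_process P (joint_process (fun t => y t) (fun i t => x i t)))
  (hstat : strictly_stationary P (joint_process (fun t => y t) (fun i t => x i t)))
  (hbeta : absolutely_regular P (joint_process (fun t => y t) (fun i t => x i t)))
  (hu_iid : forall i : 'I_n, iid P (fun t => u i t))
  (homega_iid : iid P (fun t => omega t))
  (hu_mean : forall (i : 'I_n) (t : int), ('E_P[u i t] = 0)%E)
  (homega_mean : forall t : int, ('E_P[omega t] = 0)%E)
  (* assumptions (1) and (2) *)
  (h1 : forall (i j : 'I_n) (t l : int), l != 0 -> indep P (u i t) (u j (t - l)))
  (h2 : forall (i : 'I_n) (t l : int), indep P (u i (t - l)) (omega t))
  (* C_x = E[x_t x_t'] and sigma_y^2 = Var(y_t) *)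
  (Cx : 'M[R]_n) (sy2 : R)
  (hCx : forall (t : int) (i j : 'I_n),
     ('E_P[fun w => (x i t w * x j t w)%R] = (Cx i j)%:E)%E)
  (hsy2 : forall t : int, 'V_P[y t] = sy2%:E)
  (hCx_pd : positive_definite Cx) (hsy2_pos : 0 < sy2) :
  let R2 : R := (alphas^T *m Cx *m alphas) 0 0 / sy2 in
  [/\ (* X X' / T converges in probability to C_x *)
      forall i j : 'I_n,
        cvg_in_prob P
          (fun N w => (\sum_(1 <= t < N.+1) x i t%:Z w * x j t%:Z w) / N%:R)
          (Cx i j),
      (* (a) *)
      forall (phihat : nat -> {RV P >-> R}) (alphahat : nat -> 'I_n -> {RV P >-> R}),
        (forall (N : nat) (w : T),
           ols_estimate (fun t => y t w) (fun i t => x i t w) N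
             (phihat N w) (\col_i alphahat N i w)) ->
        cvg_in_prob P (fun N => phihat N)
          (phie * (1 - R2) / (1 - phi ^+ 2 * R2)) /\
        (forall i : 'I_n, cvg_in_prob P (fun N => alphahat N i)
          (alphas i 0 * (1 - phi * phie * (1 - R2) / (1 - phi ^+ 2 * R2)))) &
      (* (b) *)
      forall (phihat : nat -> {RV P >-> R}) (alphahat : nat -> 'I_n -> {RV P >-> R}),
        (forall (N : nat) (w : T),
           ols_estimate (fun t => y t w) (fun i t => u i t w) N
             (phihat N w) (\col_i alphahat N i w)) ->
        cvg_in_prob P (fun N => phihat N)
          (phi * R2 + phie * (1 - R2)) /\
        (forall i : 'I_n, cvg_in_prob P (fun N => alphahat N i) (alphas i 0))].
Proof.
pose Z := joint_process (fun t => y t : T -> R) (fun i t => x i t : T -> R).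
have mZ t j : measurable_fun [set: T] (Z t j) by case: j.
pose V := gaussian_span P Z.
have VL4 X : V X -> L4 P X by exact: gaussian_span_L4.
have Vy t : V (y t) := gaussian_span_gen P mZ t None.
have Vx i t : V (x i t) := gaussian_span_gen P mZ t (Some i).
have Vsig t : V (signal alphas x t) by apply: gaussian_span_sum => // i; exact: Vx.
have Veps t : V (eps t).
  have VN := gaussian_spanZ (-1) (Vsig (t - 1)).
  apply: (gaussian_span_ae (gaussian_spanD (Vy t) VN)) => //.
  by apply: filterS (hy t) => w /= ->; rewrite /signal; ring.
have Vu i t : V (u i t).
  have VN := gaussian_spanZ (- phi) (Vx i (t - 1)).
  apply: (gaussian_span_ae (gaussian_spanD (Vx i t) VN)) => //.
  by apply: filterS (hx i t) => w /= ->; ring.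
have Vomega t : V (omega t).
  have VN := gaussian_spanZ (- phie) (Veps (t - 1)).
  apply: (gaussian_span_ae (gaussian_spanD (Veps t) VN)) => //.
  by apply: filterS (heps t) => w /= ->; ring.
have meanE (X : T -> R) : ('E_P[X] = 0)%E -> mean P X = 0.
  by rewrite unlock /mean /Rintegral => ->.
have u0 i t : mean P (u i t) = 0 by exact/meanE.
have o0 t : mean P (omega t) = 0 by exact/meanE.
have L1 : L4 P (cst 1) by exact: L4_cst.
have rho_fix (rho m : R) : `|rho| < 1 -> m = rho * m + 0 -> m = 0.
  move=> rho1 /eqP; rewrite addr0 -subr_eq0 -{1}[m]mul1r -mulrBl mulf_eq0 subr_eq0.
  by case/orP => [/eqP e|/eqP//]; move: rho1; rewrite -e normr1 ltxx.
have statZ t j h : mean P (Z (t + h) j) = mean P (Z t j).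
  by apply: stationary_mean => // s k; apply: VL4; exact: gaussian_span_gen.
(* the means are constant in time, so the autoregressions make them fixed points
   of multiplication by phi and phie *)
have x0 i t : mean P (x i t) = 0.
  apply: (rho_fix phi) => //.
  rewrite {1}mean_ip (ar_step (fun t => VL4 _ (Vx i t)) (fun t => VL4 _ (Vu i t)) (hx i))//.
  have := statZ (t - 1) (Some i) 1; rewrite subrK /= => ->.
  by rewrite -!mean_ip u0.
have e_y t : mean P (eps t) = mean P (y t).
  have Lsig := VL4 _ (Vsig (t - 1)).
  have -> : mean P (y t) = mean P (signal alphas x (t - 1) \+ eps t).
    apply: mean_ae; [exact: measurable_funP| |exact: hy].
    by case: (L4D Lsig (VL4 _ (Veps t))).
  rewrite meanD ?mean_ip//; last exact: VL4.
  rewrite ip_suml// ?big1 ?add0r// => [i _|i]; last exact: VL4.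
  by rewrite -mean_ip x0 mulr0.
have y0 t : mean P (y t) = 0.
  apply: (rho_fix phie) => //.
  rewrite -{1}e_y {1}mean_ip.
  rewrite (ar_step (fun t => VL4 _ (Veps t)) (fun t => VL4 _ (Vomega t)) heps)//.
  have := statZ (t - 1) None 1; rewrite subrK /= => ->.
  by rewrite -!mean_ip o0 e_y.
have gV : centered_gaussian_space P V.
  by apply: gaussian_span_centered => // t [i|]; [exact: x0|exact: y0].
have uu i j s t : s != t -> ip P (u i s) (u j t) = 0.
  move=> st; rewrite mean_indep ?u0 ?mul0r//; try exact: VL4.
  have -> : t = s - (s - t) by ring.
  by apply: h1; rewrite subr_eq0.
have uo i s t : ip P (u i s) (omega t) = 0.
  rewrite mean_indep ?u0 ?mul0r//; try exact: VL4.
  have -> : s = t - (t - s) by ring.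
  exact: h2.
have oo s t : s != t -> ip P (omega s) (omega t) = 0.
  move=> st; rewrite mean_indep ?o0 ?mul0r//; try exact: VL4.
  move=> A B mA mB; have [ind _] := homega_iid.
  have := ind [:: s; t] (fun r => if r == s then A else B).
  rewrite /= inE st => /(_ isT) H.
  have {H} : P (\bigcap_(r in [set` [:: s; t]]) (omega r @^-1` (if r == s then A else B))) =
     (\prod_(r <- [:: s; t]) P (omega r @^-1` (if r == s then A else B)))%E.
    by apply: H => r; case: ifP.
  rewrite !big_cons big_nil eqxx eq_sym (negbTE st) mule1 => <-; congr (P _).
  apply/seteqP; split => w /=.
    move=> [wA wB] r /=; rewrite !inE => /orP[/eqP->|/eqP->]; first by rewrite eqxx.
    by rewrite eq_sym (negbTE st).
  move=> H; split; first by have := H s; rewrite /= !inE eqxx; apply.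
  by have := H t; rewrite /= !inE eqxx orbT eq_sym (negbTE st); apply.
have hC t i j : ip P (x i t) (x j t) = Cx i j.
  by rewrite /ip /mean /Rintegral; have := hCx t i j; rewrite unlock => ->.
have hS t : ip P (y t) (y t) = sy2.
  have := hsy2 t; rewrite /variance unlock.
  have -> : fine 'E_P[y t] = 0 by have := y0 t; rewrite unlock.
  rewrite unlock /ip /mean /Rintegral => /(congr1 fine) /= <-; congr fine.
  by apply: eq_integral => w _; rewrite mulrfctE /= subr0.
have hy' t : {ae P, forall w, y t w = signal alphas x (t - 1) w + eps t w} := hy t.
split.
- move=> i j.
  exact: (sample_covariance_x hphi hphie gV Vy Vx Veps Vu Vomega hy' hx heps
    uu uo oo hC hS).
- move=> phihat alphahat est.
  exact: (ols_lagged_x hphi hphie gV Vy Vx Veps Vu Vomega hy' hx heps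
    uu uo oo hC hS hCx_pd hsy2_pos est).
- move=> phihat alphahat est.
  exact: (ols_lagged_u hphi hphie gV Vy Vx Veps Vu Vomega hy' hx heps
    uu uo oo hC hS hCx_pd hsy2_pos est).
Qed.
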